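(* Let $f, g \colon \mathbb{R}^n \to \mathbb{R}^n$ be polynomial maps of positive degrees $d_f$ and $d_g$, respectively. Suppose the following two conditions hold: (i) $\mathrm{SOL}(f^\infty, g^\infty) = \{0\} = \mathrm{SOL}(f^\infty, g^\infty + d)$ for some vector $d > 0$ in $\mathbb{R}^n$; and (ii) the local (topological) degree of the polynomial map $f^\infty \colon \mathbb{R}^n \to \mathbb{R}^n$ at $0$ is well-defined and nonzero. Then, for any polynomial maps $p, q \colon \mathbb{R}^n \to \mathbb{R}^n$ of degree at most $d_f - 1$ and $d_g - 1$ respectively, the set $\mathrm{SOL}(f + p, g + q)$ is nonempty and compact.
   Context: A polynomial map $f\colon\mathbb{R}^n\to\mathbb{R}^n$ is written $f=\mathcal{A}_d+\mathcal{A}_{d-1}+\cdots+\mathcal{A}_0$ with each $\mathcal{A}_k\colon\mathbb{R}^n\to\mathbb{R}^n$ a polynomial map homogeneous of degree $k$; if $\mathcal{A}_d\neq 0$, the degree of $f$ is $d$ and its leading term is $f^\infty:=\mathcal{A}_d$ (homogeneous part of highest degree of the whole map). For polynomial maps $f,g\colon\mathbb{R}^n\to\mathbb{R}^n$, $\mathrm{SOL}(f,g):=\{x\in\mathbb{R}^n : f(x)\ge 0,\ g(x)\ge 0,\ \langle f(x),g(x)\rangle=0\}$. Vector inequalities are componentwise; $d>0$ means all components of $d$ are positive, and $g^\infty+d$ is the map $x\mapsto g^\infty(x)+d$. For a bounded open set $\Omega\subset\mathbb{R}^n$, a continuous map $h\colon\overline{\Omega}\to\mathbb{R}^n$ and $y\notin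 h(\partial\Omega)$, $\deg(h,\Omega,y)$ is the (Brouwer) topological degree. If $x^*$ is the unique solution of $h(x)=y$ in $\Omega$, then $\deg(h,\Omega',y)$ is the same for all bounded open $\Omega'$ with $x^*\in\Omega'\subset\Omega$; this common value is the local degree of $h$ at $x^*$, denoted $\deg(h,x^* )$. The local degree of $h$ at $x^*$ is well-defined when such an $\Omega$ exists with $y=h(x^* )$. *)

(* Defs.v *)
From HB Require Import structures.
From mathcomp Require Import all_boot all_order all_algebra.
From mathcomp Require Import boolp classical_sets functions cardinality fsbigop.
From mathcomp Require Import reals topology normedtype.
(* The notations of mpoly clash with those of mathcomp-analysis. *)
From mathcomp Require Import -(notations) mpoly.

Set Implicit Arguments.
Unset Strict Implicit.
Unset Printing Implicit Defensive.

Import Order.TTheory GRing.Theory Num.Theory.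
Import numFieldNormedType.Exports.

Local Open Scope classical_set_scope.
Local Open Scope ring_scope.

Definition polymap (R : realType) (n : nat) : Type := 'I_n -> mpoly n R.

Definition peval (R : realType) (n : nat) (f : polymap R n) (x : 'rV[R]_n) :
    'rV[R]_n :=
  \row_i meval (fun j => x 0 j) (f i).

(* msize is the total degree plus one, and msize 0 = 0: the zero map and the
   constant maps have degree 0. *)
Definition pdegree (R : realType) (n : nat) (f : polymap R n) : nat :=
  (\max_(i < n) (mpoly.msize (f i)).-1)%N.

(* The homogeneous part is taken in the degree of the whole map, so that a
   component of smaller degree contributes 0. *)
Definition leading (R : realType) (n : nat) (f : polymap R n) : polymap R n :=
  fun i => pihomog (@mdeg n) (pdegree f) (f i).

Definition SOL (R : realType) (n : nat) (F G : 'rV[R]_n -> 'rV[R]_n) :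
    set 'rV[R]_n :=
  [set x | [/\ forall i, 0 <= F x 0 i, forall i, 0 <= G x 0 i
             & \sum_(i < n) F x 0 i * G x 0 i = 0]].

Definition boundary (T : topologicalType) (A : set T) : set T :=
  closure A `\` interior A.

(* A map defined on closure Om only is represented by a total function whose
   values outside closure Om are never used. *)
Definition admissible (R : realType) (n : nat) (h : 'rV[R]_n -> 'rV[R]_n)
    (Om : set 'rV[R]_n) (y : 'rV[R]_n) : Prop :=
  [/\ open Om, bounded_set Om, {within closure Om, continuous h}
    & ~ (h @` boundary Om) y].

Definition jacobian (R : realType) (n : nat) (g : polymap R n) (x : 'rV[R]_n) :
    'M[R]_n :=
  \matrix_(i, j) meval (fun k => x 0 k) (mderiv j (g i)).

Definition regular_value (R : realType) (n : nat) (g : polymap R n)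
    (Om : set 'rV[R]_n) (y : 'rV[R]_n) : Prop :=
  forall x, Om x -> peval g x = y -> \det (jacobian g x) != 0.

(* The big sum over an infinite support would be 0; under the conditions of
   is_degree the zeros are isolated and stay away from the boundary, so there
   are finitely many of them. *)
Definition signed_count (R : realType) (n : nat) (g : polymap R n)
    (Om : set 'rV[R]_n) (y : 'rV[R]_n) : int :=
  \sum_(x \in Om `&` peval g @^-1` [set y]) sgz (\det (jacobian g x)).

(* Analytic definition of the Brouwer degree: approximate h uniformly, closer
   than the distance from y to h(boundary), by a smooth map g having y as a
   regular value, and count the preimages of y with the sign of the Jacobian
   determinant.  Smooth approximants are taken polynomial; one exists for every
   admissible (h, Om, y) by the Weierstrass approximation theorem and Sard's
   theorem (perturbing by a constant), and the count does not depend on it.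
   As closure Om and its boundary are compact, the pointwise strict inequality
   says exactly that the sup of |g - h| over closure Om is less than the
   distance from y to h(boundary Om). *)
Definition is_degree (R : realType) (n : nat) (h : 'rV[R]_n -> 'rV[R]_n)
    (Om : set 'rV[R]_n) (y : 'rV[R]_n) (k : int) : Prop :=
  exists g : polymap R n,
    [/\ forall x z, closure Om x -> boundary Om z ->
          `|peval g x - h x| < `|h z - y|,
        regular_value g Om y
      & signed_count g Om y = k].

(* On admissible triples exactly one k satisfies is_degree, so the default value
   0 plays no role there. *)
Definition brouwer_degree (R : realType) (n : nat) (h : 'rV[R]_n -> 'rV[R]_n)
    (Om : set 'rV[R]_n) (y : 'rV[R]_n) : int :=
  xget 0 [set k | is_degree h Om y k].

(* h has a well-defined local degree at x, and it is k. *)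
Definition is_local_degree (R : realType) (n : nat)
    (h : 'rV[R]_n -> 'rV[R]_n) (x : 'rV[R]_n) (k : int) : Prop :=
  exists Om : set 'rV[R]_n,
    [/\ admissible h Om (h x),
        Om `&` [set z | h z = h x] = [set x]
      & forall Om' : set 'rV[R]_n, open Om' -> Om' x -> Om' `<=` Om ->
          brouwer_degree h Om' (h x) = k].

(* Main.v *)
Require Import Defs.
From mathcomp Require Import all_boot all_order all_fingroup all_algebra.
From mathcomp Require Import boolp classical_sets functions cardinality fsbigop.
From mathcomp Require Import reals interval_inference topology normedtype derive.
From mathcomp Require Import zify ring lra.
From mathcomp Require Import -(notations) mpoly.
Import Order.TTheory GRing.Theory Num.Theory.
Import numFieldNormedType.Exports.

(** Write F and G for the leading terms.  A point solves the complementarity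
    problem of two maps exactly when the componentwise minimum of the maps
    vanishes there, so the task is to find a zero of min (f + p, g + q).

    Consider the homotopy
      H t x = min (F x + t (f + p - F) x, G x + t (g + q - G) x + (1 - t) d).
    The maps f + p - F and g + q - G have lower degree than F and G, and so has
    the constant d because G has positive degree.  Hence, after rescaling, a
    zero of H t far away would be close to a solution on the unit sphere of the
    problem of F and G, and there is none: the zeros of all the H t stay in one
    ball ([min_map_coercive]).  This bounds the solution set, which is closed,
    and makes the degree of H t on a large box independent of t.  At t = 1 this
    is the degree of the map whose zero is wanted; at t = 0 the map is
    min (F, G + d), which vanishes at 0 only and coincides with F near 0 because
    d > 0, so that its degree is the local degree of F, which is nonzero.

    The degree theory needed for this argument is developed combinatorially.
    Divide a box by a grid, cut every cube into Kuhn's simplices, label a node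
    by the first negative coordinate of its image under the map h (one more label is
    used when there is none), and let [grid_count] add up the orientation signs of
    the simplices that carry all the labels.  Three facts make the count behave
    as a degree.

    - It depends only on the labels on the boundary of the box.  Indeed, glued
      into a torus the grid has no boundary, so the total count over the torus is
      0 ([torus_count0]), and the cubes that the gluing adds have all their nodes
      on the boundary of the box ([box_count_boundary]).

    - On a fine grid only simplices near zeros of h contribute: near a point
      where some coordinate of h is nonzero, that coordinate has a fixed sign
      and one label is missing ([full_simplices_avoid]).

    - For a linear isomorphism the count is the sign of the determinant
      ([grid_count_linear]): replacing rows one at a time deforms it, within the
      isomorphisms, to a signed permutation matrix, for which the only fully
      labelled simplex can be written down ([grid_count_signed_perm]).

    The first two facts give invariance under homotopies whose zeros stay away
    from the boundary: let the time of the homotopy vary with the distance to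
    the centre of the box, so that one map carries the beginning of the
    homotopy inside and its end on the boundary ([grid_count_homotopy]).  With
    the third fact, the count of a map with finitely many zeros, all regular, is
    the sum of the signs of the Jacobian determinants
    ([grid_count_regular_zeros]), which is how the Brouwer degree is defined
    here ([grid_count_degree]). *)

Set Implicit Arguments.
Unset Strict Implicit.
Unset Printing Implicit Defensive.

Local Open Scope ring_scope.

(** * Kuhn's triangulation of a torus and its oriented full labels *)

(** The simplices of Kuhn's triangulation of a cube are the monotone paths
    from its lowest corner [v] to the opposite corner; [s] is the order in which
    the coordinates are increased.  The addition in ['I_N.+2] is modulo N + 2, so
    that the cubes tile a torus. *)
Definition kuhn_vertex (N m : nat) (v : {ffun 'I_m -> 'I_N.+2}) (s : 'S_m)
    (j : nat) : {ffun 'I_m -> 'I_N.+2} :=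
  [ffun i => v i + ((s^-1)%g i < j)%N%:R].

(** The matrix of the labels of the vertices of a simplex, taken as
    basis vectors: its determinant is the sign of the labelling if all the labels
    occur and 0 otherwise. *)
Definition label_mx (N m : nat) (l : {ffun 'I_m -> 'I_N.+2} -> 'I_m.+1)
    (v : {ffun 'I_m -> 'I_N.+2}) (s : 'S_m) : 'M[int]_m.+1 :=
  \matrix_(j, k) (l (kuhn_vertex v s j) == k)%:R.

Definition simplex_sign (N m : nat) (l : {ffun 'I_m -> 'I_N.+2} -> 'I_m.+1)
    (v : {ffun 'I_m -> 'I_N.+2}) (s : 'S_m) : int :=
  (-1) ^+ s * \det (label_mx l v s).

(** The sign of the labelling of the facet opposite to vertex [j] if its labels
    are the nonzero ones, each occurring once, and 0 otherwise. *)
Definition facet (N m : nat) (l : {ffun 'I_m -> 'I_N.+2} -> 'I_m.+1)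
    (v : {ffun 'I_m -> 'I_N.+2}) (s : 'S_m) (j : 'I_m.+1) : int :=
  \det (row' j (col' ord0 (label_mx l v s))).

(** Each row has coordinate sum 1, so adding all columns to the first one
    turns that column into ones, along which the determinant is expanded. *)
Lemma det_indicator_rows (m : nat) (t : 'I_m.+1 -> 'I_m.+1) :
  let M := \matrix_(j, k) (t j == k)%:R : 'M[int]_m.+1 in
  \det M = \sum_(j < m.+1) (-1) ^+ j * \det (row' j (col' ord0 M)).
Proof.
move=> M.
(* Multiplication by E adds all columns to the first one. *)
pose E : 'M[int]_m.+1 := \matrix_(k, i) ((k == i) || (i == ord0))%:R.
have detE : \det E = 1.
  rewrite det_trig; first by rewrite big1 // => i _; rewrite mxE eqxx.
  apply/is_trig_mxP => i j ij; rewrite mxE.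
  by case: eqP => [e|_]; [rewrite e ltnn in ij | case: eqP => // e; rewrite e in ij].
have ME j i : (M *m E) j i = ((t j == i) || (i == ord0))%:R.
  rewrite mxE (bigD1 (t j)) //= big1 => [|k kt]; rewrite !mxE ?eqxx ?mul1r ?addr0 //.
  by rewrite eq_sym (negbTE kt) mul0r.
have -> : \det M = \det (M *m E) by rewrite det_mulmx detE mulr1.
rewrite (expand_det_col _ ord0).
apply: eq_bigr => j _; rewrite ME eqxx orbT mul1r /cofactor addn0.
congr (_ * \det _); apply/matrixP => a b; rewrite !mxE (bigD1 (t (lift j a))) //=.
rewrite big1 => [|k kt]; rewrite !mxE ?eqxx ?mul1r ?addr0 /=.
  by rewrite [lift ord0 b == ord0]eq_sym (negbTE (neq_lift _ _)) orbF.
by rewrite eq_sym (negbTE kt) mul0r.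
Qed.

Lemma simplex_sign_facets (N m : nat) l (v : {ffun 'I_m -> 'I_N.+2}) s :
  simplex_sign l v s = \sum_(j < m.+1) (-1) ^+ s * ((-1) ^+ j * facet l v s j).
Proof.
rewrite /simplex_sign /label_mx.
rewrite (det_indicator_rows (fun j : 'I_m.+1 => l (kuhn_vertex v s j))).
by rewrite big_distrr.
Qed.

(** An inner facet of a cube, that is, a path in which an intermediate vertex is
    left out, belongs to the two paths that differ by a transposition of two
    consecutive steps, and these have opposite orientations. *)
Lemma facet_inner_cancel (N m : nat) l (v : {ffun 'I_m.+1 -> 'I_N.+2})
    (j : 'I_m.+2) :
  (0 < j < m.+1)%N -> \sum_(s : 'S_m.+1) (-1) ^+ s * facet l v s j = 0.
Proof.
move=> /andP[j0 jm].
have j1m : (j.-1 < m.+1)%N by rewrite (leq_ltn_trans (leq_pred _)).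
(* The transposition of the two steps around vertex j. *)
pose t := tperm (Ordinal j1m) (Ordinal jm).
set S := LHS; suff : S = - S by lia.
rewrite {1}/S (reindex_inj (mulgI t)) /= -sumrN; apply: eq_bigr => s _.
have -> : facet l v (t * s)%g j = facet l v s j.
  congr (\det _); apply/matrixP => a b; rewrite !mxE.
  congr ((l _ == _)%:R); apply/ffunP => i; rewrite !ffunE; congr (_ + _%:R).
  have kj : lift j a != j by rewrite eq_sym neq_lift.
  rewrite invMg permM tpermV /t.
  case: tpermP => [->|->|//] /=; congr nat_of_bool; move: kj;
    rewrite -(inj_eq val_inj) /= => kj; apply/idP/idP; lia.
rewrite odd_permM odd_tperm -(inj_eq val_inj) /=.
have -> : j.-1 != j by lia.
by rewrite signr_addb mulN1r mulNr.
Qed.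

(** Leaving out the first vertex of a path is the same as leaving out the
    last vertex of the path that starts one step later and makes the first step
    of the original path last. *)
Lemma facet_outer_match (N m : nat) l (s : 'S_m.+1) :
  \sum_(v : {ffun 'I_m.+1 -> 'I_N.+2}) facet l v s ord0 =
  \sum_(v : {ffun 'I_m.+1 -> 'I_N.+2})
     facet l v (lift_perm ord_max ord0 1 * s)%g ord_max.
Proof.
(* The first step of the path. *)
pose e : {ffun 'I_m.+1 -> 'I_N.+2} := [ffun i => (i == s ord0)%:R].
rewrite [RHS](reindex_inj (addIr e)) /=; apply: eq_bigr => v _.
congr (\det _); apply/matrixP => a b; rewrite !mxE.
congr ((l _ == _)%:R); apply/ffunP => i; rewrite !ffunE -addrA; congr (_ + _).
have -> : (i == s ord0) = ((s^-1)%g i == ord0).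
  by rewrite -(inj_eq (@perm_inj _ s)) permKV.
rewrite invMg permM lift_permV invg1; set k := (s^-1)%g i.
case: (unliftP ord0 k) => [k' ->|->].
  rewrite lift_perm_lift perm1 /= /bump /= add0r.
  by congr ((nat_of_bool _)%:R); have := ltn_ord k'; have := ltn_ord a; lia.
rewrite lift_perm_id eqxx /= /bump /=.
have -> : (m < (m < a) + a)%N = false by have : (a < m.+1)%N := ltn_ord a; lia.
by rewrite addr0.
Qed.

(** On a torus every facet lies in two simplices that induce opposite
    orientations on it. *)
Theorem torus_count0 (N m : nat) (l : {ffun 'I_m.+1 -> 'I_N.+2} -> 'I_m.+2) :
  \sum_v \sum_s simplex_sign l v s = 0.
Proof.
under eq_bigr => v _ do under eq_bigr => s _ do rewrite simplex_sign_facets.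
under eq_bigr => v _ do rewrite exchange_big.
rewrite exchange_big big_ord_recl big_ord_recr /= [X in _ + (X + _)]big1; last first.
  move=> j _; rewrite big1 // => v _.
  under eq_bigr => s _ do rewrite mulrCA.
  rewrite -big_distrr /= facet_inner_cancel ?mulr0 //=.
  by have := ltn_ord j; rewrite /bump /=; lia.
rewrite add0r exchange_big [X in _ + X]exchange_big /=.
rewrite [X in _ + X](reindex_inj (mulgI (lift_perm ord_max ord0 1)%g)) /=.
rewrite -big_split big1 //= => s _.
rewrite -!big_distrr /=.
have -> : lift ord0 ord_max = ord_max :> 'I_m.+2 by apply: val_inj.
rewrite facet_outer_match; set X := \sum_(v : _) _.
rewrite odd_permM odd_lift_perm odd_perm1 /= !addbF -(signr_odd _ (bump 0 m)) expr0.
rewrite /bump leq0n add1n /=.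
by case: (odd m); case: (odd_perm s); rewrite /= ?expr0 ?expr1; lia.
Qed.

(** The box is the torus without the cubes that wrap around. *)
Definition box_count (N m : nat) (l : {ffun 'I_m -> 'I_N.+2} -> 'I_m.+1) : int :=
  \sum_(v : {ffun 'I_m -> 'I_N.+2} | [forall i, v i != ord_max])
     \sum_s simplex_sign l v s.

Lemma kuhn_vertex_wrap (N m : nat) (v : {ffun 'I_m -> 'I_N.+2}) s (j : nat) i :
  v i = ord_max ->
  kuhn_vertex v s j i = ord_max \/ kuhn_vertex v s j i = ord0.
Proof.
move=> vi; rewrite ffunE vi; case: (_ < _)%N; last by left; rewrite addr0.
by right; apply: val_inj; rewrite /= addnC modnn.
Qed.

Lemma simplex_sign_eq (N m : nat) (l l' : {ffun 'I_m -> 'I_N.+2} -> 'I_m.+1) v s :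
  (forall j : 'I_m.+1, l (kuhn_vertex v s j) = l' (kuhn_vertex v s j)) ->
  simplex_sign l v s = simplex_sign l' v s.
Proof.
by move=> ll; congr (_ * \det _); apply/matrixP => j k; rewrite !mxE ll.
Qed.

(** The count over the box is minus the count over the cubes that wrap
    around, and the vertices of those cubes all lie on the boundary of the box. *)
Lemma box_count_boundary (N m : nat)
    (l l' : {ffun 'I_m.+1 -> 'I_N.+2} -> 'I_m.+2) :
  (forall (v : {ffun 'I_m.+1 -> 'I_N.+2}) i,
     v i = ord_max \/ v i = ord0 -> l v = l' v) ->
  box_count l = box_count l'.
Proof.
move=> ll.
have E k : box_count k =
    - \sum_(v : {ffun 'I_m.+1 -> 'I_N.+2} | ~~ [forall i, v i != ord_max])
        \sum_s simplex_sign k v s.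
  apply/eqP; rewrite -addr_eq0; apply/eqP.
  rewrite -[RHS](torus_count0 k).
  by rewrite [RHS](bigID
    (fun v : {ffun 'I_m.+1 -> 'I_N.+2} => [forall i, v i != ord_max])).
rewrite !E; congr (- _); apply: eq_bigr => v /forallPn[i]; rewrite negbK => /eqP vi.
apply: eq_bigr => s _; apply: simplex_sign_eq => j.
by apply: (ll _ i); exact: kuhn_vertex_wrap.
Qed.

Lemma simplex_sign_missing_label (N m : nat)
    (l : {ffun 'I_m -> 'I_N.+2} -> 'I_m.+1) v s k :
  (forall j : 'I_m.+1, l (kuhn_vertex v s j) != k) -> simplex_sign l v s = 0.
Proof.
move=> lk; rewrite /simplex_sign (expand_det_col _ k) big1 ?mulr0 // => j _.
by rewrite mxE (negbTE (lk j)) mul0r.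
Qed.

(** * Full labels of signed permutation maps *)

Lemma kuhn_vertexE (N m : nat) (v : {ffun 'I_m -> 'I_N.+2}) s j i :
  v i != ord_max ->
  kuhn_vertex v s j i = (v i + ((s^-1)%g i < j))%N :> nat.
Proof.
rewrite -(inj_eq val_inj) ffunE /= => vi; have := ltn_ord (v i).
by case: ((s^-1)%g i < j)%N => ?; rewrite /= !modn_small ?addn0 ?addn1 //; lia.
Qed.

(** The even number of nodes in each direction keeps all nodes off the
    coordinate hyperplanes, so that no coordinate of a node vanishes and negating a
    coordinate exchanges its two signs. *)
Definition grid_point (R : realType) (m : nat) (rho : R) (M : nat)
    (v : {ffun 'I_m -> 'I_(M.*2).+2}) : 'rV[R]_m :=
  \row_i (rho * (((v i).*2)%:R - ((M.*2).+1)%:R) / ((M.*2).+1)%:R).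

(** The label is the index of the first negative coordinate, and [m] if there
    is none, because [find] then returns the length of the enumeration. *)
Definition sign_label (R : realType) (m : nat) (y : 'rV[R]_m) : 'I_m.+1 :=
  inord (find (fun i => y 0 i < 0) (enum 'I_m)).

Definition grid_count (R : realType) (m : nat) (rho : R) (M : nat)
    (h : 'rV[R]_m -> 'rV[R]_m) : int :=
  box_count (fun v : {ffun _ -> 'I_(M.*2).+2} => sign_label (h (grid_point rho v))).

Lemma sign_label_ge0 (R : realType) (m : nat) (y : 'rV[R]_m) (i : 'I_m) :
  (i < sign_label y)%N -> 0 <= y 0 i.
Proof.
rewrite /sign_label inordK; last first.
  by rewrite ltnS (leq_trans (find_size _ _)) // size_enum_ord.
by move/(before_find i); rewrite nth_ord_enum leNgt => ->.
Qed.

Lemma sign_label_lt0 (R : realType) (m : nat) (y : 'rV[R]_m) (i : 'I_m) :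
  sign_label y = i :> nat -> y 0 i < 0.
Proof.
rewrite /sign_label inordK; last first.
  by rewrite ltnS (leq_trans (find_size _ _)) // size_enum_ord.
move=> fi; have := @nth_find _ i (fun i => y 0 i < 0) (enum 'I_m).
by rewrite has_find fi size_enum_ord ltn_ord nth_ord_enum => ->.
Qed.

Lemma sign_labelE (R : realType) (m : nat) (y : 'rV[R]_m) (k : 'I_m.+1) :
  (forall i : 'I_m, (i < k)%N -> 0 <= y 0 i) ->
  (forall i : 'I_m, i = k :> nat -> y 0 i < 0) -> sign_label y = k.
Proof.
move=> yge ylt; apply: val_inj => /=; case: (ltngtP (sign_label y) k) => // lk.
- have lm : (sign_label y < m)%N by have := ltn_ord k; lia.
  have := yge (Ordinal lm) lk; rewrite leNgt => /negP[].
  exact: (@sign_label_lt0 _ _ _ (Ordinal lm)).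
- have km : (k < m)%N by have := ltn_ord (sign_label y); lia.
  have := @sign_label_ge0 _ _ y (Ordinal km) lk.
  by rewrite leNgt (ylt (Ordinal km)).
Qed.

Lemma grid_point_lt0 (R : realType) (m : nat) (rho : R) (M : nat)
    (v : {ffun 'I_m -> 'I_(M.*2).+2}) i : 0 < rho ->
  (grid_point rho v 0 i < 0) = (v i <= M)%N /\
  (0 < grid_point rho v 0 i) = (M < v i)%N.
Proof.
move=> rho0; rewrite mxE; set a := (_ - _).
have p1 : 0 < ((M.*2).+1)%:R^-1 :> R by rewrite invr_gt0 ltr0n.
rewrite pmulr_llt0 // pmulr_lgt0 // pmulr_rlt0 // pmulr_rgt0 //.
rewrite /a subr_lt0 subr_gt0 !ltr_nat; lia.
Qed.

Lemma perm_rank (m : nat) (q : 'S_m) (i : 'I_m) :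
  #|[set k : 'I_m | (q k < q i)%N]| = q i.
Proof.
have -> : [set k : 'I_m | (q k < q i)%N]
          = (q @^-1: [set k : 'I_m | (k < q i)%N])%SET.
  by apply/setP => k; rewrite !inE.
rewrite card_preimset; last exact: perm_inj.
by rewrite -sum1dep_card -(big_ord_widen m (fun=> 1%N)) ?sum1_card ?card_ord // ltnW.
Qed.

Section SignedPermutation.
Variables (m : nat) (e : pred 'I_m).

(** Sorting by this key lists the indices outside [e] in increasing order
    and then those in [e] in decreasing order. *)
Definition sweep_key (i : 'I_m) : nat := if e i then (m.*2 - i)%N else i.

Lemma sweep_key_inj : injective sweep_key.
Proof.
move=> i k; rewrite /sweep_key; have := ltn_ord i; have := ltn_ord k.
by move=> ? ?; do 2!case: ifP => _; move=> ?; apply: val_inj => /=; lia.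
Qed.

Definition sweep_rank (i : 'I_m) : nat :=
  #|[set k : 'I_m | (sweep_key k < sweep_key i)%N]|.

Lemma sweep_rank_lt i : (sweep_rank i < m)%N.
Proof.
rewrite /sweep_rank -[X in (_ < X)%N]card_ord -cardsT; apply: proper_card.
by apply/properP; split => //; exists i; rewrite !inE // ltnn.
Qed.

Lemma sweep_rank_mono i k :
  (sweep_rank i < sweep_rank k)%N = (sweep_key i < sweep_key k)%N.
Proof.
have H a b : (sweep_key a < sweep_key b)%N -> (sweep_rank a < sweep_rank b)%N.
  move=> ab; apply: proper_card; apply/properP; split.
    by apply/fintype.subsetP => c; rewrite !inE => /ltn_trans; apply.
  by exists a; rewrite !inE ?ltnn.
case: (ltngtP (sweep_key i) (sweep_key k)) => [/H//|/H/ltnW|/sweep_key_inj ->].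
  by rewrite leqNgt => /negbTE.
by rewrite ltnn.
Qed.

Lemma sweep_perm_inj : injective (fun i => Ordinal (sweep_rank_lt i)).
Proof.
move=> i k [] ik; apply: sweep_key_inj; case: (ltngtP (sweep_key i) (sweep_key k)) => //;
  by rewrite -sweep_rank_mono ik ltnn.
Qed.

Definition sweep_perm : 'S_m := perm sweep_perm_inj.

Lemma sweep_permE i : sweep_perm i = sweep_rank i :> nat.
Proof. by rewrite permE. Qed.

Lemma sweep_perm_mono i k :
  (sweep_perm i < sweep_perm k)%N = (sweep_key i < sweep_key k)%N.
Proof. by rewrite !sweep_permE sweep_rank_mono. Qed.

Lemma sweep_perm_unique (q : 'S_m) :
  (forall i k, (sweep_key i < sweep_key k)%N -> (q i < q k)%N) -> q = sweep_perm.
Proof.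
move=> qmono; apply/permP => i; apply: val_inj => /=.
rewrite sweep_permE -(perm_rank q i) /sweep_rank; congr #|pred_of_set _|.
apply/setP => k; rewrite !inE.
case: (ltngtP (sweep_key k) (sweep_key i)) => [/qmono//|/qmono/ltnW|/sweep_key_inj ->].
  by rewrite leqNgt => /negbTE.
by rewrite ltnn.
Qed.

(** The position of the label [m] on the path of the fully labelled simplex. *)
Definition sweep_pivot : nat := #|[set i | ~~ e i]|.

Lemma sweep_pivot_lt : (sweep_pivot < m.+1)%N.
Proof. by rewrite ltnS /sweep_pivot -[X in (_ <= X)%N]card_ord max_card. Qed.

Lemma sweep_perm_pivot i : (sweep_perm i < sweep_pivot)%N = ~~ e i.
Proof.
rewrite sweep_permE; case: (boolP (e i)) => ei /=.
  apply/negbTE; rewrite -leqNgt; apply: subset_leq_card; apply/fintype.subsetP => k.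
  rewrite !inE /sweep_key ei => /negbTE ->; have := ltn_ord i; have := ltn_ord k; lia.
apply: proper_card; apply/properP; split.
  apply/fintype.subsetP => k; rewrite !inE /sweep_key (negbTE ei).
  by case: (e k) => //; have := ltn_ord i; have := ltn_ord k; lia.
by exists i; rewrite !inE // ltnn.
Qed.

End SignedPermutation.

Section SignedPermutationCount.
Variables (R : realType) (m : nat) (e : pred 'I_m) (p : 'S_m).

Definition signed_perm_map (x : 'rV[R]_m) : 'rV[R]_m :=
  \row_i ((-1) ^+ e i * x 0 (p i)).

Variables (rho : R) (rho0 : 0 < rho) (M : nat).
Let l (v : {ffun 'I_m -> 'I_(M.*2).+2}) :=
  sign_label (signed_perm_map (grid_point rho v)).

Lemma signed_perm_map_lt0 (v : {ffun 'I_m -> 'I_(M.*2).+2}) i :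
  (signed_perm_map (grid_point rho v) 0 i < 0) = ((M < v (p i))%N == e i).
Proof.
rewrite mxE; have [a b] := grid_point_lt0 v (p i) rho0.
case: (e i); rewrite ?expr0 ?expr1 ?mul1r ?mulN1r ?oppr_lt0 ?a ?b.
  by rewrite eqb_id.
by rewrite eqbF_neg -leqNgt.
Qed.

Lemma signed_perm_label_lt (u : {ffun 'I_m -> 'I_(M.*2).+2}) (i : 'I_m) :
  (i < l u)%N -> (M < u (p i))%N != e i.
Proof.
by move/sign_label_ge0; rewrite leNgt signed_perm_map_lt0.
Qed.

Lemma signed_perm_label_eq (u : {ffun 'I_m -> 'I_(M.*2).+2}) (i : 'I_m) :
  l u = i :> nat -> (M < u (p i))%N = e i.
Proof. by move/sign_label_lt0; rewrite signed_perm_map_lt0 => /eqP. Qed.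

Definition central_cube : {ffun 'I_m -> 'I_(M.*2).+2} := [ffun=> inord M].

Lemma central_cubeE i : central_cube i = M :> nat.
Proof. by rewrite ffunE inordK // -addnn; lia. Qed.

(** On a fully labelled simplex every coordinate of the map changes sign,
    which determines the cube.  Label [i] occurs while coordinate [i] is negative
    and all the previous ones are not; following the path, the coordinates with
    a positive sign have to become nonnegative in increasing order before
    those with a negative sign become negative in decreasing order. *)
Lemma signed_perm_full_simplex (v : {ffun 'I_m -> 'I_(M.*2).+2}) s :
  [forall i, v i != ord_max] ->
  simplex_sign l v s != 0 -> v = central_cube /\ (p * s^-1)%g = sweep_perm e.
Proof.
move=> /forallP vmax c0.
have lab k : exists j : 'I_m.+1, l (kuhn_vertex v s j) = k.
  apply: contrapT => nex; move/negP: c0; apply.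
  apply/eqP/(simplex_sign_missing_label (k := k)) => j; apply/eqP => lj.
  by apply: nex; exists j.
(* At vertex j0 no coordinate is negative, at the vertex with label i
   coordinate i is: between the two the path has crossed direction p i. *)
have [j0 lj0] := lab ord_max.
have N0 i : (M < kuhn_vertex v s j0 (p i))%N != e i.
  by apply: signed_perm_label_lt; rewrite lj0.
have vM i : v (p i) = M :> nat.
  have [j lj] := lab (widen_ord (leqnSn m) i).
  have := signed_perm_label_eq (congr1 val lj); have := N0 i.
  rewrite !kuhn_vertexE //.
  by case: ((s^-1)%g (p i) < j)%N; case: ((s^-1)%g (p i) < j0)%N; case: (e i); lia.
split.
  apply/ffunP => i; apply: val_inj => /=.
  by rewrite central_cubeE; have := vM ((p^-1)%g i); rewrite permKV.
apply: sweep_perm_unique => i k.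
set q := (p * s^-1)%g.
have qE j a : (M < kuhn_vertex v s j (p a))%N = (q a < j)%N.
  by rewrite kuhn_vertexE // vM permM; case: ((s^-1)%g (p a) < j)%N; lia.
have N0' a : (q a < j0)%N != e a by rewrite -qE N0.
have lab' a : exists j : 'I_m.+1, (q a < j)%N = e a /\
    forall b : 'I_m, (b < a)%N -> (q b < j)%N != e b.
  have [j lj] := lab (widen_ord (leqnSn m) a); exists j; split.
    by rewrite -qE; exact: signed_perm_label_eq (congr1 val lj).
  by move=> b ba; rewrite -qE signed_perm_label_lt // lj.
have [ji [qi qlti]] := lab' i; have [jk [qk qltk]] := lab' k.
have := N0' i; have := N0' k; rewrite /sweep_key.
case ei : (e i) qi; case ek : (e k) qk => qk qi Nk Ni ik.
- have := qlti k; rewrite ek; have := ltn_ord i; have := ltn_ord k; lia.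
- have := ltn_ord i; have := ltn_ord k; lia.
- lia.
- have := qltk i; rewrite ei; lia.
Qed.

(** The labels along the path are the unnegated indices in increasing order,
    then [m], then the negated indices in decreasing order.  Up to the insertion of
    [m] this is the order in which the path uses the coordinates, so the signs of
    the two permutations differ by the number of negated indices that [m] precedes. *)
Lemma signed_perm_central_simplex s : (p * s^-1)%g = sweep_perm e ->
  simplex_sign l central_cube s = (-1) ^+ p * \prod_i (-1) ^+ e i.
Proof.
set q := sweep_perm e => qs.
have qE j a : (M < kuhn_vertex central_cube s j (p a))%N = (q a < j)%N.
  rewrite kuhn_vertexE ?central_cubeE; last first.
    by rewrite -(inj_eq val_inj) /= central_cubeE -addnn; lia.
  by rewrite -qs permM; case: ((s^-1)%g (p a) < j)%N; lia.
have qpiv i : (q i < sweep_pivot e)%N = ~~ e i by exact: sweep_perm_pivot.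
have qmono i k : (q i < q k)%N = (sweep_key e i < sweep_key e k)%N.
  exact: sweep_perm_mono.
(* J k is the position on the path of the vertex with label k. *)
pose J := lift_perm ord_max (Ordinal (sweep_pivot_lt e)) q.
have lJ k : l (kuhn_vertex central_cube s (J k)) = k.
  apply: sign_labelE => i; rewrite ?leNgt signed_perm_map_lt0 qE /J.
    case: (unliftP ord_max k) => [k' ->|->].
      rewrite lift_perm_lift /= /bump [(m <= k')%N]leqNgt ltn_ord /= add0n.
      move=> ik; have := qpiv i; have := qpiv k'; have := qmono i k'; have := qmono k' i.
      have := ltn_ord i; have := ltn_ord k'.
      by rewrite /sweep_key; case: (e i); case: (e k'); lia.
    by rewrite lift_perm_id /= qpiv => _; case: (e i).
  case: (unliftP ord_max k) => [k' ->|->]; last by rewrite /=; have := ltn_ord i; lia.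
  rewrite lift_perm_lift /= /bump [(m <= k')%N]leqNgt ltn_ord /= add0n.
  move/val_inj => <-.
  by have := qpiv i; case: (e i); lia.
have lmxE : label_mx l central_cube s = perm_mx J^-1.
  apply/matrixP => j k; rewrite !mxE -(permKV J j) lJ permK.
  by congr ((_ == _)%:R).
have pivE : (sweep_pivot e + \sum_i e i = m)%N.
  rewrite /sweep_pivot -sum1dep_card big_mkcond -big_split /=.
  rewrite -[RHS]card_ord -sum1_card; apply: eq_bigr => i _; by case: (e i).
rewrite /simplex_sign lmxE det_perm odd_permV odd_lift_perm /= -expr_sum.
rewrite -(signr_odd _ (\sum_i _)).
have -> : odd m = odd (sweep_pivot e) (+) odd (\sum_i e i) by rewrite -{1}pivE oddD.
have : odd_perm q = odd_perm p (+) odd_perm s by rewrite -qs odd_permM odd_permV.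
move=> ->; rewrite -!signr_addb; congr ((-1) ^+ nat_of_bool _).
by case: (odd (sweep_pivot e)); case: (odd_perm p); case: (odd_perm s);
  case: (odd (\sum_i _)).
Qed.

Lemma grid_count_signed_perm :
  grid_count rho M signed_perm_map = (-1) ^+ p * \prod_i (-1) ^+ e i.
Proof.
pose s0 := ((sweep_perm e)^-1 * p)%g.
have s0E : (p * s0^-1)%g = sweep_perm e by rewrite /s0 invMg invgK mulgA mulgV mul1g.
rewrite /grid_count /box_count (bigD1 central_cube) /=; last first.
  by apply/forallP => i; rewrite -(inj_eq val_inj) /= central_cubeE -addnn; lia.
rewrite [X in _ + X]big1 => [|v /andP[vmax vc]]; last first.
  apply: big1 => s _; apply/eqP; apply: contraNT vc.
  by move/(signed_perm_full_simplex vmax) => [-> _].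
rewrite addr0 (bigD1 s0) //= signed_perm_central_simplex //.
rewrite [X in _ + X]big1 ?addr0 // => s ss0.
apply/eqP; apply: contraNT ss0.
case/signed_perm_full_simplex.
  by apply/forallP => i; rewrite -(inj_eq val_inj) /= central_cubeE -addnn; lia.
by move=> _ qE; rewrite /s0 -qE invMg invgK mulgKV.
Qed.

End SignedPermutationCount.

(** * Full labels of a continuous map on a fine grid *)

Local Open Scope classical_set_scope.
Local Open Scope ring_scope.

Lemma rV_norm_leP (R : realType) (m : nat) (x : 'rV[R]_m) (c : R) :
  0 <= c -> (forall i, `|x 0 i| <= c) <-> `|x| <= c.
Proof.
move=> c0; rewrite /Num.norm /= mx_normrE; split => [xc|/bigmax_leP[_ xc] i].
  by apply/bigmax_leP; split => // ab _; rewrite [ab.1]ord1; exact: xc.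
exact: (xc (0, i)).
Qed.

Lemma rV_coord_le_norm (R : realType) (m : nat) (x : 'rV[R]_m) i :
  `|x 0 i| <= `|x|.
Proof. exact: (proj2 (rV_norm_leP x (normr_ge0 x)) (lexx _)). Qed.

Lemma compact_closed_ball (R : realType) (m : nat) (rho : R) :
  compact [set x : 'rV[R]_m | `|x| <= rho].
Proof.
apply: bounded_closed_compact.
  exists rho; split; first exact: num_real.
  by move=> M rhoM x /= xr; exact: le_trans xr (ltW rhoM).
have -> : [set x : 'rV[R]_m | `|x| <= rho]
   = Num.norm @^-1` [set y : R | y <= rho] by [].
by apply: closed_comp; [move=> x _; exact: norm_continuous | exact: closed_le].
Qed.

Lemma continuous_coord (T : topologicalType) (R : realType) (m : nat)
    (h : T -> 'rV[R]_m) i : continuous h -> continuous (fun z => h z 0 i).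
Proof.
move=> ch x; apply: (@continuous_comp _ _ _ h (fun y : 'rV[R]_m => y 0 i)).
  exact: ch.
exact: coord_continuous.
Qed.

Section Grid.
Variables (R : realType) (m : nat) (rho : R).
Hypothesis rho0 : 0 < rho.

Definition mesh (M : nat) : R := 2 * rho / ((M.*2).+1)%:R.

Lemma mesh_near (e : R) : 0 < e -> \forall M \near \oo, mesh M < e.
Proof.
move=> e0; have e1 : 0 < e / (2 * rho) by rewrite divr_gt0 // mulr_gt0.
near=> M; rewrite /mesh mulrC -ltr_pdivlMr ?mulr_gt0 //.
apply: (@le_lt_trans _ _ (M.+1%:R^-1)).
  by rewrite lef_pV2 ?posrE ?ltr0n // ler_nat ltnS -addnn leq_addr.
near: M; exact: (near_infty_natSinv_lt (PosNum e1)).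
Unshelve. all: by end_near. Qed.

Lemma grid_point_norm_le (M : nat) (v : {ffun 'I_m -> 'I_(M.*2).+2}) :
  `|grid_point rho v| <= rho.
Proof.
apply/(rV_norm_leP _ (ltW rho0)) => i.
rewrite mxE !normrM (gtr0_norm rho0) -mulrA ger_pMr // normfV.
rewrite ler_pdivrMr ?normr_gt0 ?pnatr_eq0 // mul1r [leRHS]ger0_norm //.
have vi := ltn_ord (v i).
have a : 0 <= (v i).*2%:R :> R by [].
have b : (v i).*2%:R <= 2 * (M.*2).+1%:R :> R.
  by rewrite -natrM ler_nat -[(v i).*2]mul2n leq_mul2l.
by rewrite ler_norml; apply/andP; split; lra.
Qed.

Lemma grid_point_norm_boundary (M : nat) (v : {ffun 'I_m -> 'I_(M.*2).+2}) i :
  v i = ord_max \/ v i = ord0 -> `|grid_point rho v| = rho.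
Proof.
move=> vi; apply/eqP; rewrite eq_le grid_point_norm_le /=.
apply: le_trans (rV_coord_le_norm _ i); rewrite mxE.
have p0 : (M.*2).+1%:R != 0 :> R by rewrite pnatr_eq0.
case: vi => ->; rewrite /= ?double0 ?sub0r.
  rewrite -[X in X%:R - _]mul2n natrM -{2}[(M.*2).+1%:R]mul1r -mulrBl.
  by rewrite mulrA mulfK // -{1}[2]natr1 addrK mulr1 ler_norm.
by rewrite mulrN mulNr mulfK // normrN ler_norm.
Qed.

Lemma kuhn_vertex_mesh (M : nat) (v : {ffun 'I_m -> 'I_(M.*2).+2}) s (j k : nat) :
  [forall i, v i != ord_max] ->
  `|grid_point rho (kuhn_vertex v s j) - grid_point rho (kuhn_vertex v s k)|
  <= mesh M.
Proof.
move=> /forallP vmax; have pos : 0 < (M.*2).+1%:R :> R by [].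
have m0 : 0 <= mesh M by rewrite /mesh divr_ge0 // mulr_ge0 // ltW.
apply/(rV_norm_leP _ m0) => i; rewrite !mxE !kuhn_vertexE //.
set a := ((s^-1)%g i < j)%N; set b := ((s^-1)%g i < k)%N.
rewrite (_ : _ - _ = mesh M * (a%:R - b%:R)); last first.
  rewrite /mesh -[(_ + a).*2]muln2 -[(_ + b).*2]muln2 !natrM !natrD.
  move: pos; move: (_.+1%:R) => P P0.
  by field; rewrite gt_eqF.
rewrite normrM ger0_norm // ler_piMr //.
by case: a; case: b; rewrite ?subrr ?subr0 ?sub0r ?normrN ?normr0 ?normr1.
Qed.

(** Near a point where coordinate [i] of [h] is nonzero, this coordinate has
    constant sign: if it is negative the label [m] does not occur nearby, and if
    it is positive the label [i] does not.  By compactness one mesh size serves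
    all points of [K]. *)
Lemma full_simplices_avoid (h : 'rV[R]_m -> 'rV[R]_m) (K : set 'rV[R]_m) :
  continuous h -> compact K -> (forall x, K x -> h x != 0) ->
  \forall M \near \oo, forall (v : {ffun 'I_m -> 'I_(M.*2).+2}) s (j : 'I_m.+1),
    [forall i, v i != ord_max] ->
    simplex_sign (fun u => sign_label (h (grid_point rho u))) v s != 0 ->
    ~ K (grid_point rho (kuhn_vertex v s j)).
Proof.
move=> ch cK h0.
(* P M x: some coordinate of h has constant sign on the ball around x whose
   radius is the mesh size. *)
pose P (M : nat) (x : 'rV[R]_m) := exists i,
  (forall z, `|x - z| <= mesh M -> h z 0 i < 0) \/
  (forall z, `|x - z| <= mesh M -> 0 < h z 0 i).
have : \forall M \near \oo, K `<=` P M.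
  apply: (proj1 (compact_near_coveringP K) cK) => x Kx.
  have /eqP/matrixP/existsNP[i0] : h x != 0 by exact: h0.
  move=> /existsNP[i]; rewrite ord1 mxE => /eqP hi.
  have ci : {for x, continuous (fun z => h z 0 i)}.
    exact: continuous_coord ch x.
  have [e e0 he] : exists2 e, 0 < e &
      (forall z, `|x - z| < e -> h z 0 i < 0) \/
      (forall z, `|x - z| < e -> 0 < h z 0 i).
    case: (ltrgt0P (h x 0 i)) hi => // hi _.
      have : \forall z \near x, 0 < h z 0 i by exact: (cvgr_gt _ ci).
      move=> /nbhs_ballP[e e0 xe].
      by exists e => //; right => z xz; apply: xe; rewrite mx_norm_ball.
    have : \forall z \near x, h z 0 i < 0 by exact: (cvgr_lt _ ci).
    move=> /nbhs_ballP[e e0 xe].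
    by exists e => //; left => z xz; apply: xe; rewrite mx_norm_ball.
  have e20 : 0 < e / 2 by rewrite divr_gt0.
  exists (ball x (e / 2), [set M | mesh M < e / 2]) => /=.
    by split; [exact: nbhsx_ballx | exact: mesh_near].
  move=> [x' M] [/=]; rewrite mx_norm_ball /= => xx' Me; exists i.
  have tri z : `|x' - z| <= mesh M -> `|x - z| < e.
    move=> x'z; rewrite -(subrK x' x) -addrA (le_lt_trans (ler_normD _ _)) //.
    by rewrite [e]splitr ltrD // (le_lt_trans x'z).
  by case: he => he; [left|right] => z /tri /he.
apply: filterS => M KP v s j vmax; apply: contra_neqP => /contrapT /KP[i Pi].
case: Pi => Pi.
  apply: (simplex_sign_missing_label (k := ord_max)) => k; apply/negP => /eqP lk.
  have := Pi _ (kuhn_vertex_mesh s j k vmax); rewrite ltNge => /negP; apply.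
  by apply: sign_label_ge0; rewrite lk.
apply: (simplex_sign_missing_label (k := widen_ord (leqnSn m) i)) => k.
apply/negP => /eqP lk.
have := Pi _ (kuhn_vertex_mesh s j k vmax); rewrite ltNge => /negP; apply.
by apply: ltW; apply: sign_label_lt0; rewrite lk.
Unshelve. all: by end_near. Qed.
End Grid.

Lemma grid_count_boundary (R : realType) (m : nat) (rho : R) (M : nat)
    (h h' : 'rV[R]_m.+1 -> 'rV[R]_m.+1) :
  0 < rho -> (forall x, `|x| = rho -> h x = h' x) ->
  grid_count rho M h = grid_count rho M h'.
Proof.
move=> rho0 hh; apply: box_count_boundary => v i vi; congr sign_label.
by apply: hh; exact: grid_point_norm_boundary vi.
Qed.

Lemma grid_count_eq0 (R : realType) (m : nat) (rho : R)
    (h : 'rV[R]_m -> 'rV[R]_m) :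
  0 < rho -> continuous h -> (forall x, `|x| <= rho -> h x != 0) ->
  \forall M \near \oo, grid_count rho M h = 0.
Proof.
move=> rho0 ch h0.
have near1 := full_simplices_avoid rho0 ch (compact_closed_ball (rho := rho)) h0.
apply: filterS near1 => M cM.
rewrite /grid_count /box_count big1 // => v vmax; rewrite big1 // => s _.
apply/eqP; apply: contrapT => /negP c0.
by apply: (cM v s ord0 vmax c0); exact: grid_point_norm_le.
Qed.

(** On a fine grid the vertices of a fully labelled simplex for [h] or for [h'] lie
    in [U], where the two maps have the same labels. *)
Lemma grid_count_local (R : realType) (m : nat) (rho : R) (U : set 'rV[R]_m)
    (h h' : 'rV[R]_m -> 'rV[R]_m) :
  0 < rho -> continuous h -> continuous h' -> open U ->
  (forall x, U x -> h x = h' x) ->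
  (forall x, `|x| <= rho -> ~ U x -> h x != 0 /\ h' x != 0) ->
  \forall M \near \oo, grid_count rho M h = grid_count rho M h'.
Proof.
move=> rho0 ch ch' oU hh h0.
pose K := [set x : 'rV[R]_m | `|x| <= rho] `&` ~` U.
have cK : compact K.
  apply: compact_closedI; last by exact: open_closedC.
  exact: compact_closed_ball.
have near1 := full_simplices_avoid rho0 ch cK (fun x '(conj xr xU) => (h0 x xr xU).1).
have near2 := full_simplices_avoid rho0 ch' cK (fun x '(conj xr xU) => (h0 x xr xU).2).
apply: filterS2 near1 near2 => M c1 c2.
apply: eq_bigr => v vmax; apply: eq_bigr => s _.
have [inU|] := pselect (forall j : 'I_m.+1, U (grid_point rho (kuhn_vertex v s j))).
  by apply: simplex_sign_eq => j; rewrite hh.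
move=> /existsNP[j jU].
have Kj : K (grid_point rho (kuhn_vertex v s j)).
  by split => //; exact: grid_point_norm_le.
transitivity (0 : int); last apply/esym.
  by apply/eqP; apply: contrapT => /negP c0; exact: (c1 v s j vmax c0).
by apply/eqP; apply: contrapT => /negP c0; exact: (c2 v s j vmax c0).
Qed.

(** * Homotopies *)

Lemma continuous_addf (T : topologicalType) (R : realType) (V : normedModType R)
    (f g : T -> V) :
  continuous f -> continuous g -> continuous (fun x => f x + g x).
Proof. by move=> cf cg x; apply: continuousD; [exact: cf | exact: cg]. Qed.

Lemma continuous_subf (T : topologicalType) (R : realType) (V : normedModType R)
    (f g : T -> V) :
  continuous f -> continuous g -> continuous (fun x => f x - g x).
Proof. by move=> cf cg x; apply: continuousB; [exact: cf | exact: cg]. Qed.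

Lemma continuous_scalef (T : topologicalType) (R : realType) (V : normedModType R)
    (s : T -> R) (f : T -> V) :
  continuous s -> continuous f -> continuous (fun x => s x *: f x).
Proof. by move=> cs cf x; apply: continuousZ; [exact: cs | exact: cf]. Qed.

Lemma continuous_cstf (T U : topologicalType) (a : U) : continuous (fun _ : T => a).
Proof. by move=> x; exact: cst_continuous. Qed.

Lemma continuous_idf (T : topologicalType) : continuous (fun x : T => x).
Proof. by move=> x; exact: cvg_id. Qed.

Lemma continuous_rV (T : topologicalType) (R : realType) (m : nat)
    (h : T -> 'rV[R]_m) :
  (forall i, continuous (fun z => h z 0 i)) -> continuous h.
Proof.
move=> ch x; apply/cvgrPdist_le => e e0.
have : \forall z \near x, forall i, `|h x 0 i - h z 0 i| <= e.
  by apply: filter_forall => i; have /cvgrPdist_le/(_ e e0) := ch i x.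
apply: filterS => z hz; apply/(rV_norm_leP _ (ltW e0)) => i.
by rewrite !mxE; exact: hz.
Qed.

Lemma continuous_sumr (T : topologicalType) (R : realType) (I : Type) (r : seq I)
    (P : pred I) (f : I -> T -> R) :
  (forall i, continuous (f i)) -> continuous (fun x => \sum_(i <- r | P i) f i x).
Proof.
move=> cf; elim: r => [|i r IH].
  by under eq_fun do rewrite big_nil; exact: cst_continuous.
under eq_fun do rewrite big_cons; case: (P i) => //.
by apply: continuous_addf => //; exact: cf.
Qed.

Lemma continuous_linear_map (R : realType) (m n : nat) (A : 'M[R]_(n, m)) :
  continuous (fun x : 'rV[R]_n => x *m A).
Proof.
apply: continuous_rV => i; under eq_fun do rewrite mxE.
apply: continuous_sumr => k x; apply: continuousM; last exact: cst_continuous.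
exact: coord_continuous.
Qed.

Lemma continuous_linear_comp (T : topologicalType) (R : realType) (m n : nat)
    (A : 'M[R]_(n, m)) (h : T -> 'rV[R]_n) :
  continuous h -> continuous (fun x => h x *m A).
Proof.
move=> ch x; apply: (@continuous_comp _ _ _ h (fun y : 'rV[R]_n => y *m A)).
  exact: ch.
exact: continuous_linear_map.
Qed.

(** The piecewise linear function equal to 0 up to [a] and to 1 from [b] on. *)
Definition ramp (R : realType) (a b t : R) : R :=
  Num.min 1 (Num.max 0 ((t - a) / (b - a))).

Lemma ramp_itv (R : realType) (a b t : R) : 0 <= ramp a b t <= 1.
Proof. by rewrite /ramp le_min ler01 le_max lexx /= ge_min lexx. Qed.

Lemma ramp0 (R : realType) (a b t : R) : a < b -> t <= a -> ramp a b t = 0.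
Proof.
move=> ab ta; rewrite /ramp max_l ?min_r ?ler01 //.
by rewrite pmulr_lle0 ?invr_gt0 ?subr_gt0 // subr_le0.
Qed.

Lemma ramp1 (R : realType) (a b t : R) : a < b -> b <= t -> ramp a b t = 1.
Proof.
move=> ab bt; have c : 1 <= (t - a) / (b - a).
  by rewrite ler_pdivlMr ?subr_gt0 // mul1r lerB.
by rewrite /ramp max_r ?min_l // (le_trans ler01).
Qed.

Lemma continuous_ramp (R : realType) (T : topologicalType) (a b : R) (f : T -> R) :
  continuous f -> continuous (fun x => ramp a b (f x)).
Proof.
move=> cf x.
apply: (@continuous_min R T (fun=> 1) (fun x => Num.max 0 ((f x - a) / (b - a))) x).
  exact: cst_continuous.
apply: (@continuous_max R T (fun=> 0) (fun x => (f x - a) / (b - a)) x).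
  exact: cst_continuous.
apply: continuousM; last exact: cst_continuous.
by apply: continuousB; [exact: cf | exact: cst_continuous].
Qed.

Lemma continuous_normf (T : topologicalType) (R : realType) (V : normedModType R)
    (f : T -> V) : continuous f -> continuous (fun x => `|f x|).
Proof. by move=> cf x; have cx := cf x; apply: cvg_norm cx. Qed.

Lemma continuous_norm_sub (R : realType) (m : nat) (a : 'rV[R]_m) :
  continuous (fun x : 'rV[R]_m => `|x - a|).
Proof.
apply: continuous_normf; apply: continuous_subf; first exact: continuous_idf.
exact: continuous_cstf.
Qed.

Lemma open_norm_lt (R : realType) (m : nat) (a : 'rV[R]_m) (r : R) :
  open [set x : 'rV[R]_m | `|x - a| < r].
Proof.
have -> : [set x : 'rV[R]_m | `|x - a| < r]
   = (fun x => `|x - a|) @^-1` [set y : R | y < r] by [].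
apply: open_comp; last exact: open_lt.
move=> x _; exact: continuous_norm_sub.
Qed.

(** Let the time grow with the distance to the centre, from 0 on a ball a little
    larger than that of radius [r] to 1 on the boundary of the box.  The map obtained
    agrees with [H 0] near all its zeros and with [H 1] on the boundary. *)
Lemma grid_count_homotopy (R : realType) (m : nat) (r rho : R)
    (H : R -> 'rV[R]_m.+1 -> 'rV[R]_m.+1) :
  0 < rho -> r < rho ->
  (forall tau, continuous tau -> continuous (fun x => H (tau x) x)) ->
  (forall t x, 0 <= t <= 1 -> r <= `|x| <= rho -> H t x != 0) ->
  \forall M \near \oo, grid_count rho M (H 0) = grid_count rho M (H 1).
Proof.
move=> rho0 rrho cH H0.
pose r1 := (r + rho) / 2.
have r1r : r < r1 by rewrite /r1; lra.
have r1rho : r1 < rho by rewrite /r1; lra.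
(* K is H 0 on the ball of radius r1 and H 1 on the boundary of the box. *)
pose K x := H (ramp r1 rho `|x|) x.
have cK : continuous K by apply/cH/continuous_ramp/norm_continuous.
have cH0 : continuous (H 0) by apply: (cH (fun=> 0)) => x; exact: cst_continuous.
apply: filterS (@grid_count_local _ _ rho [set x | `|x - 0| < r1] (H 0) K
  rho0 cH0 cK _ _ _).
- move=> M ->; apply: grid_count_boundary => // x xrho.
  by rewrite /K ramp1 // xrho.
- exact: open_norm_lt.
- by move=> x /=; rewrite subr0 /K => /ltW xr; rewrite ramp0.
- move=> x xrho /= /negP; rewrite subr0 -leNgt => r1x.
  by split; apply: H0; rewrite ?lexx ?ler01 ?ramp_itv ?xrho ?andbT //
    (le_trans (ltW r1r)).
Qed.

Lemma unitmx_mul_neq0 (R : realType) (m : nat) (A : 'M[R]_m) (x : 'rV[R]_m) :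
  \det A != 0 -> x != 0 -> x *m A^T != 0.
Proof.
move=> dA; apply: contra_neq => xA.
have uA : A^T \in unitmx by rewrite unitmx_tr unitmxE unitfE.
by rewrite -[x](mulmxK uA) xA mul0mx.
Qed.

Lemma grid_count_translate (R : realType) (m : nat) (rho : R)
    (A : 'M[R]_m.+1) (a : 'rV[R]_m.+1) :
  \det A != 0 -> `|a| < rho ->
  \forall M \near \oo, grid_count rho M (fun x => (x - a) *m A^T)
                     = grid_count rho M (fun x => x *m A^T).
Proof.
move=> dA arho; have rho0 : 0 < rho by rewrite (le_lt_trans _ arho).
pose H (t : R) (x : 'rV[R]_m.+1) := (x - (1 - t) *: a) *m A^T.
have := @grid_count_homotopy _ _ ((`|a| + rho) / 2) rho H rho0.
rewrite (_ : H 0 = (fun x => (x - a) *m A^T)); last first.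
  by apply/funext => x; rewrite /H subr0 scale1r.
rewrite (_ : H 1 = (fun x => x *m A^T)); last first.
  by apply/funext => x; rewrite /H subrr scale0r subr0.
apply; first lra.
  move=> tau ctau; apply: continuous_linear_comp; apply: continuous_subf.
    exact: continuous_idf.
  apply: continuous_scalef; last exact: continuous_cstf.
  by apply: continuous_subf ctau; exact: continuous_cstf.
move=> t x /andP[t0 t1] /andP[xr _]; apply: unitmx_mul_neq0 => //.
rewrite subr_eq0; apply: contraTneq xr => ->; rewrite -ltNge normrZ.
rewrite (@le_lt_trans _ _ `|a|) //; last by lra.
by rewrite ler_piMl // ger0_norm ?subr_ge0 // gerBl.
Qed.

(** The determinant is affine in the row that changes, so it does not vanish
    on the segment between two matrices whose determinants have the same sign. *)
Lemma grid_count_row_change (R : realType) (m : nat) (rho : R)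
    (A B : 'M[R]_m.+1) i :
  0 < rho -> row' i A = row' i B -> 0 < \det A * \det B ->
  \forall M \near \oo, grid_count rho M (fun x => x *m A^T)
                     = grid_count rho M (fun x => x *m B^T).
Proof.
move=> rho0 AB dAB.
pose C (t : R) := (1 - t) *: A + t *: B.
have detC t : \det (C t) = (1 - t) * \det A + t * \det B.
  apply: (@determinant_multilinear _ _ _ _ _ i).
  - by apply/rowP => k; rewrite !mxE.
  - apply/matrixP => j k; have := congr1 (fun D : 'M_(_, _) => D j k) AB.
    by rewrite !mxE => ->; ring.
  - apply/matrixP => j k; have := congr1 (fun D : 'M_(_, _) => D j k) AB.
    by rewrite !mxE => ->; ring.
pose H (t : R) (x : 'rV[R]_m.+1) := x *m (C t)^T.
have := @grid_count_homotopy _ _ (rho / 2) rho H rho0.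
rewrite (_ : H 0 = (fun x => x *m A^T)); last first.
  by apply/funext => x; rewrite /H /C subr0 scale1r scale0r addr0.
rewrite (_ : H 1 = (fun x => x *m B^T)); last first.
  by apply/funext => x; rewrite /H /C subrr scale1r scale0r add0r.
apply; first lra.
  move=> tau ctau.
  have -> : (fun x => H (tau x) x) =
      (fun x => (1 - tau x) *: (x *m A^T) + tau x *: (x *m B^T)).
    by apply/funext => x; rewrite /H /C linearD !linearZ /= mulmxDr -!scalemxAr.
  apply: continuous_addf; apply: continuous_scalef => //.
  - by apply: continuous_subf ctau; exact: continuous_cstf.
  - exact: continuous_linear_map.
  - exact: continuous_linear_map.
move=> t x /andP[t0 t1] /andP[xr _]; apply: unitmx_mul_neq0.
  rewrite detC; case: (ltrgt0P (\det A)) dAB => [dA|dA|->]; last by rewrite mul0r ltxx.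
    rewrite pmulr_rgt0 // => dB; apply/eqP; nra.
  rewrite nmulr_rgt0 // => dB; apply/eqP; nra.
by rewrite -normr_gt0; lra.
Qed.

(** * Linear isomorphisms *)

Definition signed_row (R : realType) (m : nat) (b : bool) (j : 'I_m) : 'rV[R]_m :=
  \row_k ((-1) ^+ b * (k == j)%:R).

Lemma same_sign_trans (R : realType) (a b c : R) :
  0 < a * b -> 0 < b * c -> 0 < a * c.
Proof.
move=> ab bc; have : 0 < b ^+ 2 * (a * c).
  have -> : b ^+ 2 * (a * c) = (a * b) * (b * c) by ring.
  exact: mulr_gt0.
rewrite pmulr_rgt0 // exprn_even_gt0 //=.
by apply: contraTneq ab => ->; rewrite mulr0 ltxx.
Qed.

Lemma same_sign_sgz (R : realType) (a b : R) : 0 < a * b -> sgz a = sgz b.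
Proof.
case: (ltrgt0P a) => [a0|a0|->]; last by rewrite mul0r ltxx.
  by rewrite pmulr_rgt0 // => b0; rewrite !gtr0_sgz.
by rewrite nmulr_rgt0 // => b0; rewrite !ltr0_sgz.
Qed.

(** Row [k] can be replaced by a basis vector [e_j] up to sign whenever the
    cofactor at [(k, j)] is nonzero, and the sign of [e_j] can be chosen so that the
    sign of the determinant is kept. *)
Lemma reduce_to_signed_rows (R : realType) (m : nat) (rho : R)
    (A : 'M[R]_m.+1) (k : nat) :
  0 < rho -> \det A != 0 -> (k <= m.+1)%N ->
  exists B : 'M[R]_m.+1,
    [/\ forall i : 'I_m.+1, (i < k)%N -> exists b j, row i B = signed_row R b j,
        0 < \det A * \det B
      & \forall M \near \oo, grid_count rho M (fun x => x *m A^T)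
                           = grid_count rho M (fun x => x *m B^T)].
Proof.
move=> rho0 dA; elim: k => [_|k IH km].
  exists A; split => //; last by apply: nearW.
  by rewrite -expr2 exprn_even_gt0.
have [B [Brow dAB nearB]] := IH (ltnW km).
pose i0 : 'I_m.+1 := Ordinal km.
have dB : \det B != 0 by apply: contraTneq dAB => ->; rewrite mulr0 ltxx.
have [j cj] : exists j, cofactor B i0 j != 0.
  apply: contrapT => nex; move/eqP: dB; apply; rewrite (expand_det_row _ i0).
  rewrite big1 // => j _; have [-> |cj] := eqVneq (cofactor B i0 j) 0.
    by rewrite mulr0.
  by case: nex; exists j.
(* b is the sign that keeps the sign of the determinant. *)
pose b := (cofactor B i0 j * \det B < 0).
pose B' : 'M[R]_m.+1 :=
  \matrix_(i, l) if i == i0 then signed_row R b j 0 l else B i l.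
have rB' : row i0 B' = signed_row R b j by apply/rowP => l; rewrite !mxE eqxx.
have BB' : row' i0 B = row' i0 B'.
  by apply/matrixP => i l; rewrite !mxE eq_sym (negbTE (neq_lift _ _)).
have dB' : \det B' = (-1) ^+ b * cofactor B i0 j.
  rewrite (expand_det_row _ i0) (bigD1 j) //= big1 => [|l lj]; last first.
    by rewrite !mxE eqxx (negbTE lj) mulr0 mul0r.
  rewrite addr0 !mxE !eqxx mulr1; congr (_ * _).
  rewrite /cofactor; congr (_ * \det _); apply/matrixP => r c.
  by rewrite !mxE eq_sym (negbTE (neq_lift _ _)).
have dBB' : 0 < \det B * \det B'.
  rewrite dB' mulrCA [\det B * _]mulrC /b; have := mulf_neq0 cj dB.
  case: (ltrgt0P (cofactor B i0 j * \det B)) => // cd _.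
    by rewrite expr0 mul1r.
  by rewrite expr1 mulN1r oppr_gt0.
exists B'; split.
- move=> i; rewrite ltnS leq_eqVlt => /orP[/eqP ik|ik].
    by exists b, j; rewrite -rB'; congr (row _ _); apply: val_inj.
  have [b' [j' Bi]] := Brow i ik; exists b', j'; rewrite -Bi; apply/rowP => l.
  by rewrite !mxE -(inj_eq val_inj) /= (ltn_eqF ik).
- exact: same_sign_trans dAB dBB'.
- have := grid_count_row_change rho0 BB' dBB'.
  by apply: filterS2 nearB => M -> ->.
Qed.

Theorem grid_count_linear (R : realType) (m : nat) (rho : R) (A : 'M[R]_m.+1) :
  0 < rho -> \det A != 0 ->
  \forall M \near \oo, grid_count rho M (fun x => x *m A^T) = sgz (\det A).
Proof.
move=> rho0 dA.
have [B [Brow dAB nearB]] := reduce_to_signed_rows rho0 dA (leqnn _).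
have /choice[e /choice[p Bep]] : forall i, exists b j, row i B = signed_row R b j.
  by move=> i; apply: Brow; exact: ltn_ord.
have dB : \det B != 0 by apply: contraTneq dAB => ->; rewrite mulr0 ltxx.
have BE i l : B i l = (-1) ^+ e i * (p i == l)%:R.
  by have /rowP/(_ l) := Bep i; rewrite !mxE eq_sym.
have BD : B = diag_mx (\row_i (-1) ^+ e i) *m (\matrix_(i, l) (p i == l)%:R).
  by apply/matrixP => i l; rewrite mul_diag_mx !mxE BE.
have pinj : injective p.
  move=> i l pil; apply/eqP; apply: contraNT dB => il.
  rewrite BD det_mulmx [X in _ * X](determinant_alternate il) ?mulr0 // => k.
  by rewrite !mxE pil.
have dBE : \det B = (-1) ^+ (\sum_i e i + perm pinj)%N.
  rewrite BD det_mulmx det_diag exprD; congr (_ * _).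
    by rewrite expr_sum; apply: eq_bigr => i _; rewrite mxE.
  rewrite -det_perm; congr (\det _); apply/matrixP => i l.
  by rewrite !mxE permE.
apply: filterS nearB => M ->.
have -> : (fun x => x *m B^T) = signed_perm_map e (perm pinj) :> ('rV[R]_m.+1 -> _).
  apply/funext => x; apply/rowP => i; rewrite !mxE (bigD1 (p i)) //= big1 ?addr0.
    by rewrite mxE BE eqxx mulr1 mulrC permE.
  by move=> l li; rewrite mxE BE eq_sym (negbTE li) !mulr0.
rewrite (grid_count_signed_perm _ _ rho0) -expr_sum -exprD addnC.
have -> : sgz (\det A) = sgz (\det B).
  exact: same_sign_sgz.
rewrite dBE -signr_odd -[in RHS]signr_odd.
by case: (odd _); rewrite /= ?expr1 ?expr0 ?sgzN1 ?sgz1.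
Qed.

(** * Maps with finitely many regular zeros *)

Lemma near_all_seq (T : eqType) (I : Type) (F : set_system I) (FF : Filter F)
    (s : seq T) (P : T -> I -> Prop) :
  (forall a, a \in s -> \forall i \near F, P a i) ->
  \forall i \near F, forall a, a \in s -> P a i.
Proof.
elim: s => [|b s IH] Ps; first exact: nearW.
have Pb : \forall i \near F, P b i by apply: Ps; rewrite mem_head.
have {}IH := IH (fun a as_ => Ps a (@mem_behead _ (b :: s) _ as_)).
by apply: filterS2 Pb IH => i Pbi IHi a; rewrite inE => /orP[/eqP ->|/IHi].
Qed.

Lemma common_radius (R : realType) (T : eqType) (s : seq T) (P : T -> R -> Prop) :
  (forall a r r', r' <= r -> P a r -> P a r') ->
  (forall a, a \in s -> exists2 r, 0 < r & P a r) ->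
  exists2 r, 0 < r & forall a, a \in s -> P a r.
Proof.
move=> Pdown; elim: s => [|b s IH] Ps; first by exists 1.
have [r1 r10 Pb] := Ps b (mem_head _ _).
have [r2 r20 Pr2] := IH (fun a as_ => Ps a (@mem_behead _ (b :: s) _ as_)).
exists (Num.min r1 r2); first by rewrite lt_min r10.
move=> a; rewrite inE => /orP[/eqP ->|/Pr2].
  by apply: Pdown Pb; rewrite ge_min lexx.
by apply: Pdown; rewrite ge_min lexx orbT.
Qed.

Lemma kuhn_vertex0 (N m : nat) (v : {ffun 'I_m -> 'I_N.+2}) s : kuhn_vertex v s 0 = v.
Proof. by apply/ffunP => i; rewrite ffunE ltn0 addr0. Qed.

(** Once the mesh is small compared with the distances between the zeros, a
    fully labelled simplex is near exactly one zero [a], where [h] and [k a] have the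
    same labels. *)
Lemma grid_count_sum (R : realType) (m : nat) (rho : R)
    (h : 'rV[R]_m -> 'rV[R]_m) (s : seq 'rV[R]_m)
    (k : 'rV[R]_m -> 'rV[R]_m -> 'rV[R]_m) :
  0 < rho -> uniq s -> continuous h ->
  (forall x, `|x| <= rho -> h x = 0 -> x \in s) ->
  (forall a, a \in s -> continuous (k a)) ->
  (forall a x, a \in s -> x != a -> k a x != 0) ->
  (forall a, a \in s ->
     exists2 r, 0 < r & forall x, `|x - a| < r -> k a x = h x) ->
  \forall M \near \oo, grid_count rho M h = \sum_(a <- s) grid_count rho M (k a).
Proof.
move=> rho0 us ch hs ck k0 kh.
have [r r0 Pr] : exists2 r, 0 < r & forall a, a \in s ->
    (forall x, `|x - a| < r -> k a x = h x) /\
    (forall b, b \in s -> b != a -> r <= `|a - b|).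
  apply: common_radius => [a r r' r'r [P1 P2]|a as_].
    split=> [x xr'|b bs ba]; first by apply: P1; exact: lt_le_trans xr' r'r.
    exact: le_trans r'r (P2 b bs ba).
  have [r1 r10 Pr1] := kh a as_.
  have [r2 r20 Pr2] : exists2 r, 0 < r & forall b, b \in s -> b != a -> r <= `|a - b|.
    apply: common_radius => [b r r' r'r P ba|b _]; first exact: le_trans r'r (P ba).
    have [->|ba] := eqVneq b a; first by exists 1.
    by exists `|a - b|; rewrite // normr_gt0 subr_eq0 eq_sym.
  exists (Num.min r1 r2); first by rewrite lt_min r10.
  split=> [x|b bs ba]; first by rewrite lt_min => /andP[/Pr1].
  by rewrite ge_min Pr2 ?orbT.
(* Balls of radius d around different zeros are disjoint, and simplices of mesh
   less than d that meet such a ball stay in the ball of radius r. *)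
pose d := r / 2; have d0 : 0 < d by rewrite divr_gt0.
pose cb := [set x : 'rV[R]_m | `|x| <= rho].
have cK (U : set 'rV[R]_m) : open U -> compact (cb `&` ~` U).
  move=> oU; apply: compact_closedI; first exact: compact_closed_ball.
  exact: open_closedC.
pose U := \bigcup_(a in [set` s]) [set x : 'rV[R]_m | `|x - a| < d].
have oU : open U by apply: bigcup_open => a _; exact: open_norm_lt.
have nh : forall x, (cb `&` ~` U) x -> h x != 0.
  move=> x [xr xU]; apply: contra_notN xU => /eqP hx.
  by exists x; [exact: hs | rewrite /= subrr normr0].
have near1 := full_simplices_avoid rho0 ch (cK U oU) nh.
have near2 : \forall M \near \oo, forall a, a \in s ->
    forall (v : {ffun 'I_m -> 'I_(M.*2).+2}) p (j : 'I_m.+1),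
    [forall i, v i != ord_max] ->
    simplex_sign (fun u => sign_label (k a (grid_point rho u))) v p != 0 ->
    ~ (cb `&` ~` [set x | `|x - a| < d]) (grid_point rho (kuhn_vertex v p j)).
  apply: near_all_seq => a as_; apply: full_simplices_avoid => //; first exact: ck.
    by apply: cK; exact: open_norm_lt.
  move=> x [_ /= xa]; apply: k0 => //; apply: contra_notN xa => /eqP ->.
  by rewrite subrr normr0.
have near3 := mesh_near rho0 d0.
apply: filterS3 near1 near2 near3 => M c1 c2 Md.
rewrite /grid_count /box_count [RHS]exchange_big /=; apply: eq_bigr => v vmax.
rewrite [RHS]exchange_big /=; apply: eq_bigr => p _.
have vr : cb (grid_point rho v) by exact: grid_point_norm_le.
have [[a as_ /= va]|vU] := pselect (U (grid_point rho v)); last first.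
  rewrite big_seq big1 => [|a as_].
    apply/eqP; apply: contrapT => /negP c0.
    by apply: (c1 v p ord0 vmax c0); rewrite kuhn_vertex0.
  apply/eqP; apply: contrapT => /negP c0.
  apply: (c2 a as_ v p ord0 vmax c0); rewrite kuhn_vertex0; split => //= va.
  by apply: vU; exists a.
rewrite (bigD1_seq a) //= big_seq_cond [X in _ + X]big1 ?addr0.
  apply: simplex_sign_eq => j; congr sign_label; apply/esym/(Pr a as_).1.
  rewrite -(subrK (grid_point rho v) (grid_point rho _)) -addrA.
  rewrite (le_lt_trans (ler_normD _ _)) // [r]splitr ltr_leD //; last exact: ltW.
  by rewrite -{2}(kuhn_vertex0 v p) (le_lt_trans (kuhn_vertex_mesh _ _ _ _ _)).
move=> b /andP[bs ba]; apply/eqP; apply: contrapT => /negP c0.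
apply: (c2 b bs v p ord0 vmax c0); rewrite kuhn_vertex0; split => //= vb.
have := (Pr a as_).2 b bs ba; apply/negP; rewrite -ltNge.
rewrite -(subrK (grid_point rho v) a) -addrA (le_lt_trans (ler_normD _ _)) //.
by rewrite [r]splitr distrC ltrD.
Qed.

(** Near each zero [a] the map is interpolated to its linear part at [a];
    the interpolation has no other zero than [a], and on the boundary of the box it
    is the linear part. *)
Theorem grid_count_regular_zeros (R : realType) (m : nat) (rho : R)
    (h : 'rV[R]_m.+1 -> 'rV[R]_m.+1) (s : seq 'rV[R]_m.+1)
    (A : 'rV[R]_m.+1 -> 'M[R]_m.+1) :
  0 < rho -> uniq s -> continuous h ->
  (forall a, a \in s -> `|a| < rho) ->
  (forall x, `|x| <= rho -> h x = 0 -> x \in s) ->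
  (forall a, a \in s -> \det (A a) != 0) ->
  (forall a, a \in s -> exists2 r, 0 < r & forall x, `|x - a| <= r ->
     `|h x - (x - a) *m (A a)^T| <= 2^-1 * `|(x - a) *m (A a)^T|) ->
  \forall M \near \oo, grid_count rho M h = \sum_(a <- s) sgz (\det (A a)).
Proof.
move=> rho0 us ch srho hs dA lin.
have [r r0 Pr] : exists2 r, 0 < r & forall a, a \in s ->
    r <= (rho - `|a|) / 2 /\ forall x, `|x - a| <= r ->
     `|h x - (x - a) *m (A a)^T| <= 2^-1 * `|(x - a) *m (A a)^T|.
  apply: common_radius => [a r r' r'r [P1 P2]|a as_].
    split=> [|x xr']; first exact: le_trans P1.
    by apply: P2; exact: le_trans r'r.
  have [r1 r10 Pr1] := lin a as_.
  exists (Num.min r1 ((rho - `|a|) / 2)).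
    by rewrite lt_min r10 divr_gt0 // subr_gt0 srho.
  by split=> [|x]; [rewrite ge_min lexx orbT | rewrite le_min => /andP[/Pr1]].
pose L a x : 'rV[R]_m.+1 := (x - a) *m (A a)^T.
(* k a is h near a and its linear part L a at distance at least r from a. *)
pose k a x := L a x + (1 - ramp (r / 2) r `|x - a|) *: (h x - L a x).
have r2r : r / 2 < r by lra.
have cL a : continuous (L a).
  apply: continuous_linear_comp; apply: continuous_subf; first exact: continuous_idf.
  exact: continuous_cstf.
have near1 : \forall M \near \oo,
    grid_count rho M h = \sum_(a <- s) grid_count rho M (k a).
  apply: grid_count_sum => //.
  - move=> a as_; apply: continuous_addf; first exact: cL.
    apply: continuous_scalef; last exact: continuous_subf.
    apply: continuous_subf; first exact: continuous_cstf.
    by apply: continuous_ramp; exact: continuous_norm_sub.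
  - move=> a x as_ xa.
    have L0 : 0 < `|L a x|.
      by rewrite normr_gt0 /L unitmx_mul_neq0 ?dA // subr_eq0.
    have [xr|xr] := lerP `|x - a| r; last first.
      by rewrite /k ramp1 ?(ltW xr) // subrr scale0r addr0 -normr_gt0.
    rewrite /k addrC; apply: contraTneq (((Pr a as_).2 x xr)) => /eqP.
    rewrite addr_eq0 => /eqP E; rewrite -ltNge.
    apply: (@lt_le_trans _ _ `|L a x|); first by rewrite -/(L a x); lra.
    have -> : `|L a x| = `|1 - ramp (r / 2) r `|x - a| | * `|h x - L a x|.
      by rewrite -normrZ E normrN.
    rewrite ler_piMl // ler_norml.
    by have /andP[] := ramp_itv (r / 2) r `|x - a|; lra.
  - move=> a as_; exists (r / 2) => [|x xr]; first by rewrite divr_gt0.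
    by rewrite /k ramp0 ?(ltW xr) // subr0 scale1r addrC subrK.
have near2 : \forall M \near \oo, forall a, a \in s ->
    grid_count rho M (k a) = sgz (\det (A a)).
  apply: near_all_seq => a as_.
  have kL M : grid_count rho M (k a) = grid_count rho M (L a).
    apply: grid_count_boundary => // x xrho.
    rewrite /k ramp1 ?subrr ?scale0r ?addr0 //.
    have := lerB_dist x a; have := (Pr a as_).1; have := srho a as_.
    by rewrite xrho; lra.
  have := grid_count_translate (dA a as_) (srho a as_).
  by apply: filterS2 (grid_count_linear rho0 (dA a as_)) => M -> <-; rewrite kL.
apply: filterS2 near1 near2 => M -> kA.
by rewrite big_seq [RHS]big_seq; apply: eq_bigr => a /kA.
Qed.

(** * Polynomial maps: first-order expansion and growth *)

Lemma mpoly_ring_ind (R : realType) (n : nat) (P : mpoly n R -> Prop) :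
  (forall c, P (mpolyC n c)) -> (forall i, P (mpolyX R (mnm1 i))) ->
  (forall p q, P p -> P q -> P (p + q)) ->
  (forall p q, P p -> P q -> P (p * q)) -> forall p, P p.
Proof.
move=> PC PX PD PM; have P1 : P 1 by rewrite -mpolyC1.
elim/mpolyind => [|c m p _ _ Pp]; first by rewrite -mpolyC0.
apply: PD => //; rewrite -mul_mpolyC; apply: (PM) => //.
rewrite mpolyXE_id; apply: big_ind => // i _.
by elim: (m i) => [|k IH]; rewrite ?expr0 // exprS; exact: (PM).
Qed.

Lemma continuous_meval (R : realType) (n : nat) (p : mpoly n R) :
  continuous (fun x : 'rV[R]_n => meval (fun j => x 0 j) p).
Proof.
elim/mpoly_ring_ind: p => [c|i|p q cp cq|p q cp cq].
- under eq_fun do rewrite mevalC; exact: continuous_cstf.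
- under eq_fun do rewrite mevalXU; exact: coord_continuous.
- by under eq_fun do rewrite mevalD; exact: continuous_addf.
- under eq_fun do rewrite mevalM.
  by move=> x; apply: continuousM; [exact: cp | exact: cq].
Qed.

Lemma continuous_peval (R : realType) (n : nat) (f : polymap R n) :
  continuous (peval f).
Proof.
apply: continuous_rV => i; under eq_fun do rewrite mxE; exact: continuous_meval.
Qed.

(** The derivative of [p] at [a] in the direction [u]. *)
Definition gradient (R : realType) (n : nat) (p : mpoly n R) (a u : 'rV[R]_n) : R :=
  \sum_k meval (fun j => a 0 j) (mderiv k p) * u 0 k.

Lemma gradient_bound (R : realType) (n : nat) (p : mpoly n R) (a : 'rV[R]_n) :
  exists2 L, 0 <= L & forall u, `|gradient p a u| <= L * `|u|.
Proof.
exists (\sum_k `|meval (fun j => a 0 j) (mderiv k p)|).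
  by apply: sumr_ge0 => k _.
move=> u; rewrite mulr_suml; apply: le_trans (ler_norm_sum _ _ _) _.
by apply: ler_sum => k _; rewrite normrM ler_wpM2l // rV_coord_le_norm.
Qed.

(** The product rule for first-order expansions with quadratic remainders
    [Rp] and [Rq], at distance [t] from the base point. *)
Lemma product_remainder (R : realType) (p0 q0 Dp Dq Rp Rq Lp Lq Cp Cq t : R) :
  0 <= t <= 1 -> 0 <= Lp -> 0 <= Lq -> 0 <= Cp -> 0 <= Cq ->
  `|Dp| <= Lp * t -> `|Dq| <= Lq * t -> `|Rp| <= Cp * t ^+ 2 -> `|Rq| <= Cq * t ^+ 2 ->
  `|(p0 + Dp + Rp) * (q0 + Dq + Rq) - p0 * q0 - (p0 * Dq + q0 * Dp)|
  <= (`|p0| * Cq + Lp * (Lq + Cq) + Cp * (`|q0| + Lq + Cq)) * t ^+ 2.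
Proof.
move=> /andP[t0 t1] Lp0 Lq0 Cp0 Cq0 hDp hDq hRp hRq.
rewrite (_ : _ - _ - _ = p0 * Rq + Dp * (Dq + Rq) + Rp * (q0 + Dq + Rq)); last by ring.
have hDR : `|Dq + Rq| <= (Lq + Cq) * t.
  rewrite mulrDl (le_trans (ler_normD _ _)) // lerD //.
  by rewrite (le_trans hRq) // ler_wpM2l // expr2 ler_piMl.
have hq : `|q0 + Dq + Rq| <= `|q0| + Lq + Cq.
  rewrite -!addrA (le_trans (ler_normD _ _)) // lerD2l (le_trans hDR) //.
  by rewrite ler_piMr // addr_ge0.
apply: le_trans (ler_normD _ _) _; rewrite [leRHS]mulrDl; apply: lerD.
  apply: le_trans (ler_normD _ _) _; rewrite [leRHS]mulrDl; apply: lerD; rewrite normrM.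
    by rewrite -mulrA ler_wpM2l.
  have -> : Lp * (Lq + Cq) * t ^+ 2 = (Lp * t) * ((Lq + Cq) * t) by ring.
  by rewrite ler_pM.
by rewrite normrM mulrAC ler_pM.
Qed.

(** First-order expansions with quadratic remainder exist for constants and
    variables and are inherited by sums and products. *)
Lemma meval_taylor1 (R : realType) (n : nat) (p : mpoly n R) (a : 'rV[R]_n) :
  exists2 C, 0 <= C & forall x, `|x - a| <= 1 ->
    `|meval (fun j => x 0 j) p - meval (fun j => a 0 j) p - gradient p a (x - a)|
    <= C * `|x - a| ^+ 2.
Proof.
elim/mpoly_ring_ind: p => [c|i|p q [Cp Cp0 hp] [Cq Cq0 hq]|p q [Cp Cp0 hp] [Cq Cq0 hq]].
- exists 0 => // x _; rewrite !mevalC subrr sub0r normrN mul0r /gradient big1 ?normr0 //.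
  by move=> k _; rewrite mderivC meval0 mul0r.
- exists 0 => // x _; rewrite !mevalXU mul0r /gradient (bigD1 i) //= big1 => [|k ki].
    rewrite mderivX mnm1E eqxx scale1r.
    have -> : mnm_sub (mnm1 i) (mnm1 i) = mnm0.
      by apply/mnmP => k; rewrite mnmBE mnm0E subnn.
    by rewrite mpolyX0 meval1 mul1r addr0 !mxE subrr normr0.
  by rewrite mderivX mnm1E eq_sym (negbTE ki) scale0r meval0 mul0r.
- exists (Cp + Cq); first exact: addr_ge0.
  move=> x xa; have := lerD (hp x xa) (hq x xa); rewrite -mulrDl; apply: le_trans.
  rewrite (le_trans _ (ler_normD _ _)) // le_eqVlt; apply/orP; left; apply/eqP.
  congr `|_|; rewrite !mevalD.
  have -> : gradient (p + q) a (x - a) = gradient p a (x - a) + gradient q a (x - a).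
    by rewrite -big_split; apply: eq_bigr => k _; rewrite mderivD mevalD mulrDl.
  ring.
- have [Lp Lp0 gp] := gradient_bound p a; have [Lq Lq0 gq] := gradient_bound q a.
  set p0 := meval (fun j => a 0 j) p in hp *; set q0 := meval (fun j => a 0 j) q in hq *.
  exists (`|p0| * Cq + Lp * (Lq + Cq) + Cp * (`|q0| + Lq + Cq)).
    by rewrite !addr_ge0 ?mulr_ge0 ?addr_ge0.
  move=> x xa; rewrite !mevalM -/p0 -/q0.
  have -> : gradient (p * q) a (x - a) =
      p0 * gradient q a (x - a) + q0 * gradient p a (x - a).
    rewrite /gradient !mulr_sumr -big_split; apply: eq_bigr => k _.
    by rewrite mderivM mevalD !mevalM -/p0 -/q0 /=; ring.
  have := @product_remainder R p0 q0 _ _ _ _ Lp Lq Cp Cq `|x - a| _ Lp0 Lq0 Cp0 Cq0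
    (gp (x - a)) (gq (x - a)) (hp x xa) (hq x xa).
  rewrite normr_ge0 xa => /(_ isT); congr (`|_| <= _); ring.
Qed.

Lemma linear_lower_bound (R : realType) (m : nat) (A : 'M[R]_m) :
  \det A != 0 -> exists2 K, 0 < K & forall u : 'rV[R]_m, `|u| <= K * `|u *m A^T|.
Proof.
move=> dA; have uA : A^T \in unitmx by rewrite unitmx_tr unitmxE unitfE.
pose B := invmx A^T; pose K := 1 + \sum_i \sum_k `|B k i|.
have S0 : 0 <= \sum_i \sum_k `|B k i| by apply: sumr_ge0 => i _; apply: sumr_ge0.
have K0 : 0 < K by rewrite /K ltr_pwDl.
exists K => // u; rewrite -{1}[u](mulmxK uA) -/B; move: (u *m A^T) => w.
have Kw : 0 <= K * `|w| by rewrite mulr_ge0 // ltW.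
apply/(rV_norm_leP _ Kw) => i; rewrite mxE.
apply: le_trans (ler_norm_sum _ _ _) _.
apply: (@le_trans _ _ ((\sum_k `|B k i|) * `|w|)).
  rewrite mulr_suml; apply: ler_sum => k _.
  by rewrite normrM mulrC ler_wpM2l // rV_coord_le_norm.
rewrite ler_wpM2r // /K [X in _ <= 1 + X](bigD1 i) //= addrCA lerDl.
by rewrite addr_ge0 // sumr_ge0 // => j _; apply: sumr_ge0.
Qed.

Lemma peval_regular_zero (R : realType) (m : nat) (g : polymap R m) (a : 'rV[R]_m) :
  peval g a = 0 -> \det (Defs.jacobian g a) != 0 ->
  exists2 r, 0 < r & forall x, `|x - a| <= r ->
    `|peval g x - (x - a) *m (Defs.jacobian g a)^T|
    <= 2^-1 * `|(x - a) *m (Defs.jacobian g a)^T|.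
Proof.
move=> ga dJ; have [K K0 hK] := linear_lower_bound dJ.
have /choice[C hC] : forall i, exists C, 0 <= C /\ forall x, `|x - a| <= 1 ->
    `|peval g x 0 i - ((x - a) *m (Defs.jacobian g a)^T) 0 i| <= C * `|x - a| ^+ 2.
  move=> i; have [C C0 hC] := meval_taylor1 (g i) a; exists C; split => // x xa.
  have := hC x xa; congr (`|_| <= _); rewrite !mxE.
  have -> : meval (fun j => a 0 j) (g i) = 0 by have /rowP/(_ i) := ga; rewrite !mxE.
  rewrite subr0 /gradient; congr (_ - _); apply: eq_bigr => k _.
  by rewrite !mxE mulrC.
pose D := 1 + \sum_i C i.
have D0 : 0 < D by rewrite ltr_pwDl // sumr_ge0 // => i _; exact: (hC i).1.
have CD i : C i <= D.
  rewrite /D (bigD1 i) //= addrCA lerDl addr_ge0 // sumr_ge0 // => j _.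
  exact: (hC j).1.
exists (Num.min 1 (2 * K * D)^-1).
  by rewrite lt_min ltr01 invr_gt0 !mulr_gt0.
move=> x; rewrite le_min => /andP[xa1 xa].
set y := (x - a) *m _; have hy := hK (x - a); rewrite -/y in hy.
have y0 : 0 <= 2^-1 * `|y| by rewrite mulr_ge0.
apply/(rV_norm_leP _ y0) => i; rewrite [X in `|X|]mxE [X in _ + X]mxE.
apply: le_trans ((hC i).2 x xa1) _.
apply: (@le_trans _ _ (D * ((2 * K * D)^-1 * `|x - a|))).
  by rewrite expr2 ler_pM ?(hC i).1 ?mulr_ge0 // ler_wpM2r.
have -> : D * ((2 * K * D)^-1 * `|x - a|) = 2^-1 * (`|x - a| / K).
  by field; rewrite !gt_eqF.
by rewrite ler_wpM2l // ler_pdivrMr // mulrC.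
Qed.

Lemma meval_pihomogZ (R : realType) (n d : nat) (p : mpoly n R) (x : 'rV[R]_n) (c : R) :
  meval (fun j => (c *: x) 0 j) (pihomog (@mdeg n) d p) =
  c ^+ d * meval (fun j => x 0 j) (pihomog (@mdeg n) d p).
Proof.
rewrite !pihomogE !raddf_sum /= mulr_sumr; apply: eq_bigr => m /eqP md.
rewrite !mevalZ !mevalX mulrCA; congr (_ * _).
rewrite -md mdegE -prodrXr -big_split; apply: eq_bigr => i _.
by rewrite mxE exprMn.
Qed.

Lemma peval_leadingZ (R : realType) (n : nat) (f : polymap R n) (x : 'rV[R]_n) (c : R) :
  peval (leading f) (c *: x) = c ^+ pdegree f *: peval (leading f) x.
Proof. by apply/rowP => i; rewrite !mxE meval_pihomogZ. Qed.

Definition grows_at_most (R : realType) (n : nat) (k : nat)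
    (phi : 'rV[R]_n -> R) : Prop :=
  exists2 C, 0 <= C & forall x, 1 <= `|x| -> `|phi x| <= C * `|x| ^+ k.

Lemma grows_at_mostD (R : realType) (n : nat) (k : nat) (phi psi : 'rV[R]_n -> R) :
  grows_at_most k phi -> grows_at_most k psi ->
  grows_at_most k (fun x => phi x + psi x).
Proof.
move=> [C C0 hC] [D D0 hD]; exists (C + D); first exact: addr_ge0.
by move=> x x1; rewrite (le_trans (ler_normD _ _)) // mulrDl lerD ?hC ?hD.
Qed.

Lemma grows_at_most_sum (R : realType) (n : nat) (k : nat) (I : eqType) (r : seq I)
    (P : pred I) (phi : I -> 'rV[R]_n -> R) :
  (forall i, i \in r -> P i -> grows_at_most k (phi i)) ->
  grows_at_most k (fun x => \sum_(i <- r | P i) phi i x).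
Proof.
elim: r => [|i r IH] hphi.
  by exists 0 => // x _; rewrite big_nil normr0 mul0r.
have {}IH : grows_at_most k (fun x => \sum_(i <- r | P i) phi i x).
  by apply: IH => j jr; apply: hphi; rewrite inE jr orbT.
under eq_fun do rewrite big_cons.
case Pi : (P i) => //; apply: grows_at_mostD => //.
by apply: hphi; rewrite ?mem_head.
Qed.

Lemma grows_at_most_mpoly (R : realType) (n : nat) (k : nat) (p : mpoly n R) :
  (forall m, m \in msupp p -> mdeg m <= k)%N ->
  grows_at_most k (fun x : 'rV[R]_n => meval (fun j => x 0 j) p).
Proof.
move=> pk; under eq_fun do rewrite mevalE.
apply: grows_at_most_sum => m /pk mk _; exists `|mcoeff m p| => // x x1.
rewrite normrM ler_wpM2l // normr_prod (@le_trans _ _ (`|x| ^+ mdeg m)) //.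
  rewrite mdegE -prodrXr; apply: ler_prod => i _.
  by rewrite normr_ge0 normrX /= lerXn2r ?nnegrE ?normr_ge0 // rV_coord_le_norm.
exact: ler_weXn2l.
Qed.

Lemma msize_pdegree (R : realType) (n : nat) (f : polymap R n) i :
  (mmeasure (@mdeg n) (f i) <= (pdegree f).+1)%N.
Proof.
apply: leq_trans (leqSpred _) _; rewrite ltnS.
exact: (leq_bigmax (F := fun i => (mmeasure (@mdeg n) (f i)).-1)).
Qed.

(** Without its homogeneous part of degree [pdegree f], the component [f i] is the
    sum of its homogeneous parts of smaller degrees. *)
Lemma lower_terms_growth (R : realType) (n : nat) (f p : polymap R n) i :
  (pdegree p <= pdegree f - 1)%N ->
  grows_at_most (pdegree f - 1)%N
    (fun x => peval (f \+ p) x 0 i - peval (leading f) x 0 i).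
Proof.
move=> hp.
have -> : (fun x : 'rV[R]_n => peval (f \+ p) x 0 i - peval (leading f) x 0 i) =
    (fun x => \sum_(e < pdegree f) meval (fun j => x 0 j) (pihomog (@mdeg n) e (f i)) +
              meval (fun j => x 0 j) (p i)).
  apply/funext => x; rewrite !mxE mevalD addrAC; congr (_ + _).
  rewrite {1}(pihomog_partitionE (msize_pdegree f i)) big_ord_recr mevalD addrK.
  by rewrite raddf_sum.
apply: grows_at_mostD.
  apply: grows_at_most_sum => e _ _; apply: grows_at_most_mpoly => m.
  have := pihomogP (@mdeg n) e (f i); move=> /dhomogP/(_ m) h /h ->.
  by have := ltn_ord e; lia.
apply: grows_at_most_mpoly => m /msize_mdeg_lt; have := msize_pdegree p i; lia.
Qed.

(** * Complementarity problems and the local degree *)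

(** On the compact set where [theta] is nonpositive the norm has a maximum,
    which is less than [r]. *)
Lemma shell_of_sphere (R : realType) (m : nat) (theta : 'rV[R]_m -> R) (r : R) :
  0 < r -> continuous theta -> (forall x, `|x| = r -> 0 < theta x) ->
  exists r1, [/\ 0 <= r1, r1 < r & forall x, r1 < `|x| <= r -> 0 < theta x].
Proof.
move=> r0 ct tr.
pose S := [set x : 'rV[R]_m | `|x| <= r] `&` [set x | theta x <= 0].
have cS : compact S.
  apply: compact_closedI; first exact: compact_closed_ball.
  have -> : [set x | theta x <= 0] = theta @^-1` [set y : R | y <= 0] by [].
  by apply: closed_comp; [move=> x _; exact: ct | exact: closed_le].
have [S0|S0] := pselect (S !=set0); last first.
  exists 0; split => // x /andP[_ xr]; rewrite ltNge; apply: contra_notN S0 => tx.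
  by exists x.
have cn : {within S, continuous (fun x : 'rV[R]_m => `|x|)}.
  by apply: continuous_subspaceT; exact: norm_continuous.
have [c cinS cmax] := EVT_max_rV S0 cS cn.
have [cr tc] := set_mem cinS.
exists `|c|; split => //.
  rewrite lt_neqAle cr andbT; apply: contraTneq tc => /tr; rewrite ltNge => /negP tc.
  exact/negP.
move=> x /andP[cx xr]; rewrite ltNge; apply/negP => tx.
by have := cmax x (mem_set (conj xr tx)); rewrite leNgt cx.
Qed.

(** The polynomial map [g] that computes the degree can be grafted into [K]:
    as [g] is closer to [F] than [F] is to 0 on a shell around the sphere of radius
    [r], interpolating between the two on that shell creates no zero there. *)
Lemma grid_count_degree (R : realType) (m : nat) (F K : 'rV[R]_m.+1 -> 'rV[R]_m.+1)
    (r rho : R) (k : int) :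
  continuous F -> continuous K -> 0 < r -> r < rho ->
  (forall x, `|x| <= r -> K x = F x) ->
  (forall x, `|x| <= rho -> x != 0 -> K x != 0) ->
  is_degree F [set x | `|x| < r] 0 k -> k != 0 ->
  \forall M \near \oo, grid_count rho M K = k.
Proof.
move=> cF cK r0 rrho KF K0 [g [gF greg gk]] k0.
have rho0 : 0 < rho by exact: lt_trans rrho.
have cg := continuous_peval (f := g).
have ballE : [set x : 'rV[R]_m.+1 | `|x| < r] = ball (0 : 'rV[R]_m.+1) r.
  by rewrite mx_norm_ball; apply/seteqP; split => x /=; rewrite sub0r normrN.
have clB x : `|x| <= r -> closure [set x : 'rV[R]_m.+1 | `|x| < r] x.
  rewrite ballE closure_ballE closed_ballE // /closed_ball_ /=.
  by rewrite sub0r normrN.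
have bdB x : `|x| = r -> boundary [set x : 'rV[R]_m.+1 | `|x| < r] x.
  move=> xr; split; first by apply: clB; rewrite xr.
  by move/interior_subset; rewrite /= xr ltxx.
have [r1 [r10 r1r shell]] : exists r1, [/\ 0 <= r1, r1 < r &
    forall x, r1 < `|x| <= r -> 0 < `|F x| - `|peval g x - F x|].
  apply: shell_of_sphere => //.
    apply: continuous_subf; apply: continuous_normf => //.
    exact: continuous_subf.
  move=> x xr; rewrite subr_gt0; have := gF x x (clB x _) (bdB x xr).
  by rewrite subr0; apply; rewrite xr.
pose r2 := (r1 + r) / 2.
have r12 : r1 < r2 by rewrite /r2; lra.
have r2r : r2 < r by rewrite /r2; lra.
(* h is g on the ball of radius r2 and K outside the ball of radius r. *)
pose h x := K x + (1 - ramp r2 r `|x|) *: (peval g x - F x).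
have ch : continuous h.
  apply: continuous_addf => //; apply: continuous_scalef.
    apply: continuous_subf; first exact: continuous_cstf.
    by apply: continuous_ramp; exact: norm_continuous.
  exact: continuous_subf.
have hg x : `|x| <= r2 -> h x = peval g x.
  move=> xr; rewrite /h ramp0 // subr0 scale1r KF ?(le_trans xr) ?(ltW r2r) //.
  by rewrite addrC subrK.
have hK x : r <= `|x| -> h x = K x.
  by move=> xr; rewrite /h ramp1 // subrr scale0r addr0.
have h0 x : `|x| <= rho -> r1 < `|x| -> h x != 0.
  move=> xrho xr1; have [xr|xr] := lerP `|x| r; last first.
    by rewrite hK ?(ltW xr) // K0 // -normr_gt0 (le_lt_trans r10).
  have := shell x; rewrite xr1 xr subr_gt0 => /(_ isT) gFx.
  rewrite /h KF //; apply/eqP => /eqP; rewrite addr_eq0 => /eqP FE.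
  have {FE}FE : `|F x| = `|1 - ramp r2 r `|x| | * `|peval g x - F x|.
    by rewrite -normrZ -[RHS]normrN -FE.
  move: gFx; rewrite [ltRHS]FE ltNge ler_piMl // ler_norml.
  by have /andP[] := ramp_itv r2 r `|x|; lra.
pose Z := [set x : 'rV[R]_m.+1 | `|x| < r] `&` peval g @^-1` [set 0].
have Zfin : finite_set Z.
  apply: contrapT => Zinf; move/eqP: k0; apply; rewrite -gk.
  apply: fsbig_dflt; apply: contra_not Zinf; apply: sub_finite_set => x [xr gx].
  by split => //=; apply/eqP; rewrite sgz_eq0; exact: greg.
have [s us sZ] : exists2 s : seq 'rV[R]_m.+1, uniq s & Z = [set` s].
  have /finite_seqP[s ->] := Zfin; exists (undup s); first exact: undup_uniq.
  by apply/seteqP; split => x /=; rewrite mem_undup.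
have ZE a : a \in s <-> Z a by rewrite sZ.
have Zr1 a : a \in s -> `|a| <= r1.
  move=> /ZE[/= ar ga]; rewrite leNgt; apply/negP => ra.
  have := shell a; rewrite ra (ltW ar) => /(_ isT).
  by rewrite ga sub0r normrN subrr ltxx.
apply: filterS (@grid_count_regular_zeros R m rho h s
  (fun a => Defs.jacobian g a) rho0 us ch _ _ _ _) => [M hM|a aZ|x xrho hx|a|a aZ].
- rewrite -gk /signed_count -/Z sZ -fsbig_seq // -hM; apply/esym.
  apply: grid_count_boundary => // x xrho.
  by rewrite hK // xrho ltW.
- by rewrite (le_lt_trans (Zr1 a aZ)) // (lt_trans r1r).
- have xr1 : `|x| <= r1 by rewrite leNgt; apply: contraTN isT => /(h0 x xrho)/eqP.
  apply/ZE; split => /=; first exact: le_lt_trans r1r.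
  by rewrite -hg // (le_trans xr1) // ltW.
- by move=> /ZE[/= ar ga]; exact: greg.
- have [ar ga] : Z a by apply/ZE.
  have [r3 r30 hr3] := peval_regular_zero ga (greg a ar ga).
  exists (Num.min r3 (r2 - r1)); first by rewrite lt_min r30 subr_gt0.
  move=> x; rewrite le_min => /andP[xr3 xr]; rewrite hg; first exact: hr3.
  have := Zr1 a aZ; have := ler_normD (x - a) a; rewrite subrK; lra.
Qed.

Definition min_map (R : realType) (n : nat) (y z : 'rV[R]_n) : 'rV[R]_n :=
  \row_i Num.min (y 0 i) (z 0 i).

Lemma SOL_min_map (R : realType) (n : nat) (F G : 'rV[R]_n -> 'rV[R]_n) x :
  SOL F G x <-> min_map (F x) (G x) = 0.
Proof.
split=> [[Fx Gx /eqP FG]|/rowP H].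
  apply/rowP => i; rewrite !mxE; move: FG.
  rewrite psumr_eq0 => [/allP/(_ i)|j _]; last exact: mulr_ge0.
  rewrite mem_index_enum => /(_ isT); rewrite mulf_eq0 => /orP[] /eqP ->.
    by rewrite min_l.
  by rewrite min_r.
have FG i : 0 <= F x 0 i /\ 0 <= G x 0 i.
  have := H i; rewrite !mxE => e; split.
    by rewrite -e ge_min lexx.
  by rewrite -e ge_min lexx orbT.
split=> [i|i|]; [exact: (FG i).1|exact: (FG i).2|].
apply: big1 => i _; have := H i; rewrite !mxE.
by case: (lerP (F x 0 i) (G x 0 i)) => _ ->; rewrite ?mul0r ?mulr0.
Qed.

Lemma continuous_min_map (T : topologicalType) (R : realType) (n : nat)
    (F G : T -> 'rV[R]_n) :
  continuous F -> continuous G -> continuous (fun x => min_map (F x) (G x)).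
Proof.
move=> cF cG; apply: continuous_rV => i; under eq_fun do rewrite mxE.
move=> x; apply: (@continuous_min R T (fun x => F x 0 i) (fun x => G x 0 i) x).
  exact: continuous_coord cF x.
exact: continuous_coord cG x.
Qed.

(** If the minimum vanishes at [x] then dividing by the powers of the norm
    of [x] shows that the minimum of [F] and [G] at the point [x / `|x|] of the unit
    sphere is at most [C / `|x|], while it is bounded away from 0 on the sphere. *)
Lemma min_map_coercive (R : realType) (m df dg : nat) (F G : 'rV[R]_m.+1 -> 'rV[R]_m.+1)
    (C : R) :
  0 <= C -> continuous F -> continuous G ->
  (forall (c : R) x, F (c *: x) = c ^+ df.+1 *: F x) ->
  (forall (c : R) x, G (c *: x) = c ^+ dg.+1 *: G x) ->
  SOL F G `<=` [set 0] ->
  exists2 rho0, 1 <= rho0 & forall x y z : 'rV[R]_m.+1, rho0 <= `|x| ->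
    (forall i, `|y 0 i| <= C * `|x| ^+ df) -> (forall i, `|z 0 i| <= C * `|x| ^+ dg) ->
    min_map (F x + y) (G x + z) != 0.
Proof.
move=> C0 cF cG hF hG FG.
pose S := [set u : 'rV[R]_m.+1 | `|u| <= 1] `&` [set u | 1 <= `|u|].
have cS : compact S.
  apply: compact_closedI; first exact: compact_closed_ball.
  have -> : [set u : 'rV[R]_m.+1 | 1 <= `|u|] = Num.norm @^-1` [set y : R | 1 <= y] by [].
  by apply: closed_comp; [move=> x _; exact: norm_continuous | exact: closed_ge].
have S0 : S !=set0.
  exists (const_mx 1); split => /=.
    by apply/(rV_norm_leP _ ler01) => i; rewrite mxE normr1.
  by have := rV_coord_le_norm (const_mx 1 : 'rV[R]_m.+1) ord0; rewrite mxE normr1.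
have cn : {within S, continuous (fun u => `|min_map (F u) (G u)|)}.
  by apply: continuous_subspaceT; apply: continuous_normf; exact: continuous_min_map.
have [u0 /set_mem[_ u01] u0min] := EVT_min_rV S0 cS cn.
set c := `|min_map (F u0) (G u0)| in u0min.
have c0 : 0 < c.
  rewrite normr_gt0; apply: contraTneq u01 => /SOL_min_map/FG ->.
  by rewrite normr0 ler10.
exists (1 + C / c); first by rewrite lerDl divr_ge0 // ltW.
move=> x y z xr hy hz; apply/eqP => /rowP H.
have x0 : 0 < `|x| by apply: lt_le_trans xr; rewrite ltr_pwDl // divr_ge0 // ltW.
pose u := `|x|^-1 *: x.
have xu : x = `|x| *: u by rewrite /u scalerA divff ?scale1r // gt_eqF.
have uS : u \in S.
  have -> : u \in S = true; last by [].
  by apply/mem_set; split => /=; rewrite /u normrZ normfV normr_id mulVf ?gt_eqF.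
have Cx : C / `|x| < c.
  have Cc : C / c < `|x| by apply: lt_le_trans xr; rewrite ltrDr.
  by rewrite ltr_pdivrMr // mulrC -ltr_pdivrMr.
suff : `|min_map (F u) (G u)| <= C / `|x|.
  by move=> h; have := le_lt_trans (le_trans (u0min u uS) h) Cx; rewrite ltxx.
have Cx0 : 0 <= C / `|x| by rewrite divr_ge0.
have scaled d (a b s : R) : a = `|x| ^+ d.+1 * s -> `|b| <= C * `|x| ^+ d ->
    (0 <= a + b -> - (C / `|x|) <= s) /\ (a + b = 0 -> s <= C / `|x|).
  move=> -> hb; have p0 : 0 < `|x| ^+ d.+1 by rewrite exprn_gt0.
  have Cp : C * `|x| ^+ d = `|x| ^+ d.+1 * (C / `|x|).
    by rewrite exprS; field; rewrite gt_eqF.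
  move: hb; rewrite Cp ler_norml => /andP[b1 b2]; split => [ab|ab].
    by rewrite -(ler_pM2l p0) mulrN; lra.
  by rewrite -(ler_pM2l p0); lra.
apply/(rV_norm_leP _ Cx0) => i; rewrite mxE.
have Fu : F x 0 i = `|x| ^+ df.+1 * F u 0 i by rewrite {1}xu hF mxE.
have Gu : G x 0 i = `|x| ^+ dg.+1 * G u 0 i by rewrite {1}xu hG mxE.
have [Fi1 Fi2] := @scaled df _ (y 0 i) _ Fu (hy i).
have [Gi1 Gi2] := @scaled dg _ (z 0 i) _ Gu (hz i).
have := H i; rewrite !mxE => AB.
have A0 : 0 <= F x 0 i + y 0 i by rewrite -AB ge_min lexx.
have B0 : 0 <= G x 0 i + z 0 i by rewrite -AB ge_min lexx orbT.
rewrite ler_norml le_min ge_min Fi1 // Gi1 //=; apply/orP.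
by case: (lerP (F x 0 i + y 0 i) (G x 0 i + z 0 i)) AB => _ e;
  [left; exact: Fi2 | right; exact: Gi2].
Qed.

Lemma lower_terms_bound (R : realType) (n : nat) (f p : polymap R n) :
  (pdegree p <= pdegree f - 1)%N ->
  exists2 C, 0 <= C & forall x i, 1 <= `|x| ->
    `|(peval (f \+ p) x - peval (leading f) x) 0 i| <= C * `|x| ^+ (pdegree f).-1.
Proof.
move=> hp; have /choice[C hC] : forall i, exists C, 0 <= C /\ forall x, 1 <= `|x| ->
    `|peval (f \+ p) x 0 i - peval (leading f) x 0 i| <= C * `|x| ^+ (pdegree f).-1.
  move=> i; have [C C0 hC] := lower_terms_growth i hp.
  by exists C; split => // x x1; rewrite -subn1; exact: hC.
exists (\sum_i C i); first by apply: sumr_ge0 => i _; exact: (hC i).1.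
move=> x i x1; have := (hC i).2 x x1; rewrite !mxE => /le_trans; apply.
rewrite ler_wpM2r ?exprn_ge0 // (bigD1 i) //= lerDl sumr_ge0 // => j _.
exact: (hC j).1.
Qed.

(** As [k] is nonzero it cannot be the default value of [brouwer_degree], so it
    is attained by some approximation. *)
Lemma local_degree_small_ball (R : realType) (m : nat) (F : 'rV[R]_m.+1 -> 'rV[R]_m.+1)
    (k : int) (P : set 'rV[R]_m.+1) :
  F 0 = 0 -> is_local_degree F 0 k -> k != 0 -> nbhs (0 : 'rV[R]_m.+1) P ->
  exists2 r, 0 < r & is_degree F [set x | `|x| < r] 0 k /\ forall x, `|x| <= r -> P x.
Proof.
move=> F0 [Om [[oOm _ _ _] OmF deg]] k0 /nbhs_ballP[e e0 eP].
have [Om0 _] : (Om `&` [set z | F z = F 0]) 0 by rewrite OmF.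
have /nbhs_ballP[e' e'0 eOm] : nbhs (0 : 'rV[R]_m.+1) Om by exact: open_nbhs_nbhs.
pose r := Num.min e e' / 2.
have mu0 : 0 < Num.min e e' by rewrite lt_min e0.
have r0 : 0 < r by rewrite divr_gt0.
have rb x : `|x| <= r -> ball (0 : 'rV[R]_m.+1) e x /\ ball (0 : 'rV[R]_m.+1) e' x.
  move=> xr; have : `|x| < Num.min e e' by rewrite (le_lt_trans xr) // /r; lra.
  by rewrite mx_norm_ball /= sub0r normrN lt_min => /andP[].
exists r => //; split; last by move=> x /rb[/eP].
have degr : brouwer_degree F [set x | `|x| < r] 0 = k.
  rewrite -[X in brouwer_degree _ _ X]F0; apply: deg.
  - rewrite (_ : [set x | _] = [set x | `|x - 0| < r]); first exact: open_norm_lt.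
    by apply/seteqP; split => x /=; rewrite subr0.
  - by rewrite /= normr0.
  - by move=> x /= /ltW/rb[_ /eOm].
move: degr; rewrite /brouwer_degree; case: xgetP => [k' _ dk' <- //|_ k00].
by rewrite -k00 eqxx in k0.
Qed.

(** Polynomials enter the argument only through the growth bounds on lower
    order terms, so it is carried out for continuous maps that are asymptotic to
    homogeneous ones. *)
Theorem asymptotic_solvability (R : realType) (m df dg : nat)
    (F G f g : 'rV[R]_m.+1 -> 'rV[R]_m.+1) (d : 'rV[R]_m.+1) (C : R) (k : int) :
  continuous F -> continuous G -> continuous f -> continuous g ->
  (forall (c : R) x, F (c *: x) = c ^+ df.+1 *: F x) ->
  (forall (c : R) x, G (c *: x) = c ^+ dg.+1 *: G x) ->
  0 <= C ->
  (forall x i, 1 <= `|x| -> `|(f x - F x) 0 i| <= C * `|x| ^+ df) ->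
  (forall x i, 1 <= `|x| -> `|(g x - G x) 0 i| <= C * `|x| ^+ dg) ->
  (forall i, 0 < d 0 i) ->
  SOL F G = [set 0] -> SOL F (fun x => G x + d) = [set 0] ->
  is_local_degree F 0 k -> k != 0 ->
  SOL f g !=set0 /\ compact (SOL f g).
Proof.
move=> cF cG cf cg homF homG C0 hf hg d0 FG0 FGd0 Fk k0.
have F0 : F 0 = 0 by have := homF 0 0; rewrite scaler0 expr0n scale0r.
have G0 : G 0 = 0 by have := homG 0 0; rewrite scaler0 expr0n scale0r.
(* H 1 is the map whose zeros are the solutions, H 0 is F near 0. *)
pose H t x := min_map (F x + t *: (f x - F x))
  (G x + (t *: (g x - G x) + (1 - t) *: d)).
have H1 : H 1 = fun x => min_map (f x) (g x).
  apply/funext => x; rewrite /H subrr scale0r addr0 !scale1r.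
  by rewrite ![_ x + (_ - _)]addrC !subrK.
have H0 : H 0 = fun x => min_map (F x) (G x + d).
  by apply/funext => x; rewrite /H !scale0r subr0 scale1r addr0 add0r.
have cH tau : continuous tau -> continuous (fun x => H (tau x) x).
  move=> ctau.
  apply: continuous_min_map; apply: continuous_addf; [exact: cF| |exact: cG|].
    by apply: continuous_scalef ctau _; exact: continuous_subf.
  apply: continuous_addf; apply: continuous_scalef; [exact: ctau| | |].
  - exact: continuous_subf.
  - by apply: continuous_subf ctau; exact: continuous_cstf.
  - exact: continuous_cstf.
have [rho0 rho01 coer] : exists2 rho0, 1 <= rho0 & forall t x,
    0 <= t <= 1 -> rho0 <= `|x| -> H t x != 0.
  have D0 : 0 <= C + `|d| by rewrite addr_ge0.
  have FGs : SOL F G `<=` [set 0] by rewrite FG0.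
  have [rho0 rho01 coer] := min_map_coercive D0 cF cG homF homG FGs.
  exists rho0 => // t x /andP[t0 t1] xr; have x1 := le_trans rho01 xr.
  apply: coer => // i; rewrite mulrDl.
    apply: (@le_trans _ _ (C * `|x| ^+ df)); last by rewrite lerDl mulr_ge0 ?exprn_ge0.
    apply: le_trans (hf x i x1).
    by rewrite mxE normrM ger0_norm // ler_piMl.
  rewrite mxE (le_trans (ler_normD _ _)) // lerD //.
    apply: le_trans (hg x i x1).
    by rewrite mxE normrM ger0_norm // ler_piMl.
  apply: (@le_trans _ _ `|d|); last by rewrite ler_peMr // exprn_ege1.
  rewrite mxE normrM ger0_norm ?subr_ge0 // (le_trans _ (rV_coord_le_norm d i)) //.
  by rewrite ler_piMl // gerBl.
split; last first.
  apply: bounded_closed_compact.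
    exists rho0; split; first exact: num_real.
    move=> M rhoM x /SOL_min_map fgx; rewrite /= leNgt; apply/negP => Mx.
    have := coer 1 x; rewrite ler01 lexx (ltW (lt_trans rhoM Mx)) H1 fgx eqxx.
    by move=> /(_ isT isT).
  have -> : SOL f g = (fun x => `|min_map (f x) (g x)|) @^-1` [set y : R | y <= 0].
    apply/seteqP; split => x /=; rewrite normr_le0; first by move/SOL_min_map/eqP.
    by move/eqP/SOL_min_map.
  apply: closed_comp; last exact: closed_le.
  by move=> x _; apply: continuous_normf; exact: continuous_min_map.
apply: contrapT => noSOL.
have H1n0 x : H 1 x != 0.
  by apply/eqP; rewrite H1 => fgx; apply: noSOL; exists x; apply/SOL_min_map.
have Fsmall : nbhs (0 : 'rV[R]_m.+1) [set x | forall i, F x 0 i <= G x 0 i + d 0 i].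
  have near_i i : \forall x \near (0 : 'rV[R]_m.+1), F x 0 i <= G x 0 i + d 0 i.
    pose phi x := G x 0 i + d 0 i - F x 0 i.
    have cphi : continuous phi.
      apply: continuous_subf; last exact: continuous_coord cF.
      apply: continuous_addf; first exact: continuous_coord cG.
      exact: continuous_cstf.
    have phi0 : 0 < phi 0 by rewrite /phi F0 G0 !mxE add0r subr0.
    have : \forall x \near (0 : 'rV[R]_m.+1), 0 < phi x by exact: (cvgr_gt _ (cphi 0)).
    by apply: filterS => x; rewrite /phi subr_gt0 => /ltW.
  by have := filter_forall _ near_i; apply.
have [r r0 [degF Fr]] := local_degree_small_ball F0 Fk k0 Fsmall.
pose rho := rho0 + r.
have rho_gt0 : 0 < rho by rewrite /rho; lra.
have near0 : \forall M \near \oo, grid_count rho M (H 0) = k.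
  apply: (@grid_count_degree R m F (H 0) r rho k) => //.
  - by apply: (cH (fun=> 0)); exact: continuous_cstf.
  - by rewrite /rho; lra.
  - by move=> x /Fr hx; rewrite H0; apply/rowP => i; rewrite !mxE min_l.
  - move=> x _ x0; rewrite H0; apply: contra_neq x0 => e.
    have : SOL F (fun x => G x + d) x by apply/SOL_min_map.
    by rewrite FGd0.
have near01 : \forall M \near \oo, grid_count rho M (H 0) = grid_count rho M (H 1).
  apply: (@grid_count_homotopy R m rho0 rho H) => //.
    by rewrite /rho; lra.
  by move=> t x t01 /andP[xr _]; exact: coer.
have near1 : \forall M \near \oo, grid_count rho M (H 1) = 0.
  apply: grid_count_eq0 => //.
  by apply: (cH (fun=> 1)); exact: continuous_cstf.
have [M [e0 [e01 e1]]] := filter_ex (filterI near0 (filterI near01 near1)).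
by move/eqP: k0; apply; rewrite -e0 e01 e1.
Qed.

Theorem proposition4p6 (R : realType) (n : nat) (f g : polymap R n)
  (hf : (0 < pdegree f)%N) (hg : (0 < pdegree g)%N)
  (hi : SOL (peval (leading f)) (peval (leading g)) = [set 0] /\
        exists d : 'rV[R]_n, (forall i, 0 < d 0 i) /\
          SOL (peval (leading f)) (fun x => peval (leading g) x + d) = [set 0])
  (hii : exists k : int, is_local_degree (peval (leading f)) 0 k /\ k <> 0)
  (p q : polymap R n)
  (hp : (pdegree p <= pdegree f - 1)%N) (hq : (pdegree q <= pdegree g - 1)%N) :
  SOL (peval (f \+ p)) (peval (g \+ q)) !=set0 /\
  compact (SOL (peval (f \+ p)) (peval (g \+ q))).
Proof.
case: n => [|m] in f g hf hg hi hii p q hp hq *.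
  by move: hf; rewrite /pdegree big_ord0.
case: hi => FG0 [d [d0 FGd0]]; case: hii => k [Fk /eqP k0].
have [Cf Cf0 hCf] := lower_terms_bound hp.
have [Cg Cg0 hCg] := lower_terms_bound hq.
apply: (@asymptotic_solvability R m (pdegree f).-1 (pdegree g).-1
  (peval (leading f)) (peval (leading g)) _ _ d (Cf + Cg) k) => //.
- exact: continuous_peval.
- exact: continuous_peval.
- exact: continuous_peval.
- exact: continuous_peval.
- by move=> c x; rewrite prednK //; exact: peval_leadingZ.
- by move=> c x; rewrite prednK //; exact: peval_leadingZ.
- exact: addr_ge0.
- move=> x i x1; apply: le_trans (hCf x i x1) _.
  by rewrite ler_wpM2r ?exprn_ge0 // lerDl.
- move=> x i x1; apply: le_trans (hCg x i x1) _.
  by rewrite ler_wpM2r ?exprn_ge0 // lerDr.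
Qed.
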